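(* Let $T$ be a locally finite tree with root $x_0$. Assume that $T$ contains an infinite binary sub-tree $\overline T$ rooted at $x_0$, such that for some $M>0$, $$\sup_{x\in\overline T}d_x\le M.$$ Then $T$ is transient and $$h_*>0.$$
   Context: $T$ is a locally finite tree (locally finite connected graph without loops) with root $x_0$, each edge having unit weight. For $x\ne x_0$, $x^-$ is the parent of $x$ (last site before $x$ on the geodesic from $x_0$ to $x$). $d_x=|\{y\in T;\ y^-=x\}|$ is the number of children of $x$ in $T$. An infinite binary sub-tree rooted at $x_0$ is a sub-tree $\overline T$ containing $x_0$ in which every vertex has exactly two children. Transient means that simple random walk $(X_k)_{k\ge0}$ on $T$ is transient. In this case, with $E_x$ the expectation for the walk started at $x$ and ${\rm deg}(x)$ the degree of $x$, the Green function is $g(x,y)=\frac{1}{{\rm deg}(y)}E_x[\sum_{k\ge0}1\{X_k=y\}]$; under $\mathbb P^G$, $(\varphi_x)_{x\in T}$ is the Gaussian free field on $T$: a centered Gaussian field with covariance $g(\cdot,\cdot)$; and $h_*=\inf\{h\in\mathbb R;\ \mathbb P^G\text{-a.s., all connected components of }\{x\in T;\varphi_x\ge h\}\text{ are finite}\}$, $\inf\emptyset=\infty$. *)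

(* Defs.v *)
From HB Require Import structures.
From mathcomp Require Import all_boot all_order all_algebra.
From mathcomp Require Import finmap.
From mathcomp Require Import all_classical all_reals all_analysis.

Set Implicit Arguments.
Unset Strict Implicit.
Unset Printing Implicit Defensive.

Import Order.TTheory GRing.Theory Num.Theory.

Local Open Scope classical_set_scope.
Local Open Scope ring_scope.

(* A walk from x is a sequence p with [path e x p]; it visits x :: p and ends
   at [last x p]. *)

Definition neighbors (V : choiceType) (e : rel V) (x : V) : set V :=
  [set y | e x y].

Definition deg (V : choiceType) (e : rel V) (x : V) : nat :=
  #|` fset_set (neighbors e x)|.

(* The connected component of x in the subgraph induced on A; it is empty when
   x is not in A. *)
Definition cluster_of (V : choiceType) (e : rel V) (A : set V) (x : V) : set V :=
  [set y | exists p, [/\ path e x p, forall z, z \in x :: p -> A z &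
                         last x p = y]].

Definition connected_in (V : choiceType) (e : rel V) (A : set V) : Prop :=
  forall x y, A x -> A y -> cluster_of e A x y.

(* [c] is read cyclically: a pair of neighbours is a cycle of size 2, so only
   cycles of size at least 3 are excluded. *)
Definition acyclic_graph (V : choiceType) (e : rel V) : Prop :=
  forall c, cycle e c -> uniq c -> (size c <= 2)%N.

Definition locally_finite_tree (V : choiceType) (e : rel V) : Prop :=
  [/\ symmetric e, irreflexive e, connected_in e [set: V], acyclic_graph e &
      forall x, finite_set (neighbors e x)].

Definition geodesic (V : choiceType) (e : rel V) (x : V) (p : seq V) : Prop :=
  path e x p /\
  forall q, path e x q -> last x q = last x p -> (size p <= size q)%N.

(* y is the last site before x on the geodesic from x0 to x; this never holds
   for x = x0. *)
Definition is_parent (V : choiceType) (e : rel V) (x0 y x : V) : Prop :=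
  exists p, geodesic e x0 (rcons p x) /\ last x0 p = y.

Definition children (V : choiceType) (e : rel V) (x0 x : V) : set V :=
  [set y | is_parent e x0 x y].

Definition nb_children (V : choiceType) (e : rel V) (x0 x : V) : nat :=
  #|` fset_set (children e x0 x)|.

(* A sub-tree is given by its vertex set S: a connected subgraph of a tree is
   induced.  As S contains the root x0 and is connected, parents in S and in
   the whole tree coincide. *)
Definition binary_subtree (V : choiceType) (e : rel V) (x0 : V) (S : set V)
    : Prop :=
  [/\ S x0, connected_in e S &
      forall x, S x -> #|` fset_set (children e x0 x `&` S)| = 2%N].

Definition srw_step (R : realType) (V : choiceType) (e : rel V) (x y : V) : R :=
  if e x y then (deg e x)%:R^-1 else 0.

(* Under [P x], the process X is the simple random walk started at x: the
   probability that (X_0, ..., X_n) = x :: p is the product of the transition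
   probabilities along x :: p.  The case p = [::] gives X_0 = x a.s. *)
Definition is_srw (R : realType) (V : choiceType) (e : rel V)
    (d : measure_display) (W : measurableType d)
    (P : V -> probability W R) (X : nat -> W -> V) : Prop :=
  (forall k y, measurable (X k @^-1` [set y])) /\
  (forall x p, P x [set w | mkseq (X ^~ w) (size p).+1 = x :: p] =
               (\prod_(r <- pairmap (srw_step R e) x p) r)%:E).

Definition transient (R : realType) (V : choiceType)
    (d : measure_display) (W : measurableType d)
    (P : V -> probability W R) (X : nat -> W -> V) : Prop :=
  forall x, (P x [set w | exists k, (0 < k)%N /\ X k w = x] < 1)%E.

Definition green (R : realType) (V : choiceType) (e : rel V)
    (d : measure_display) (W : measurableType d)
    (P : V -> probability W R) (X : nat -> W -> V) (x y : V) : \bar R :=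
  (((deg e y)%:R^-1)%:E *
   \int[P x]_w (\sum_(0 <= k <oo) (\1_(X k @^-1` [set y]) w)%:E))%E.

(* [normal_prob m 0] is by convention the uniform law on [0, 1], hence the
   separate degenerate case. *)
Definition gaussian_law (R : realType) (m s : R) : set R -> \bar R :=
  if s == 0 then \d_m else normal_prob m s.

Definition gaussian_rv (R : realType) (d : measure_display)
    (Omega : measurableType d) (P : probability Omega R) (Y : Omega -> R)
    : Prop :=
  exists m s : R, forall B : set R, measurable B ->
    P (Y @^-1` B) = gaussian_law m s B.

Definition centered_gaussian_field (R : realType) (V : choiceType)
    (C : V -> V -> \bar R) (d : measure_display) (Omega : measurableType d)
    (P : probability Omega R) (phi : V -> {RV P >-> R}) : Prop :=
  [/\ forall (s : seq V) (a : V -> R),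
        gaussian_rv P (fun w => \sum_(x <- s) a x * phi x w),
      forall x, ('E_P[phi x] = 0)%E &
      forall x y, covariance P (phi x) (phi y) = C x y].

Definition h_star (R : realType) (V : choiceType) (e : rel V)
    (d : measure_display) (Omega : measurableType d)
    (P : probability Omega R) (phi : V -> {RV P >-> R}) : \bar R :=
  ereal_inf [set h%:E | h in
    [set h : R | {ae P, forall w, forall x,
       finite_set (cluster_of e [set y | h <= phi y w] x)}]].

(* Main.v *)
(* Giving z the weight 2^-k, k being the number of vertices of S on the geodesic
   from x0 to z (x0 excluded), yields a superharmonic function; truncated at its
   value at y in S, it dominates Green's function with pole at y up to the factor
   deg y.  Hence the walk is transient and g(y, y) <= 1 on S.

   Along S, phi y = a phi (parent y) + zeta y, where a = g(y, parent y) /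
   g(parent y, parent y) is at least 1 / (M + 1) and the Gaussian noises zeta are
   uncorrelated because Green's function factors through the edge above y; their
   variances lie in [1 / (M + 1), 1].  Independence of the noises, in the form of
   product formulas, follows from the Fourier transform of the Gaussian law and
   the density of trigonometric polynomials.

   A child of a vertex with phi > h keeps phi > h as soon as zeta > h, which for h
   near 0 has probability near 1/2; a child of a vertex with phi > 1 keeps phi > h
   as soon as zeta > - delta, with probability at least 1/2 + g; and either gets
   phi > 1 when zeta > 1, with probability at least p.  As every vertex has two
   children in S, this two-type branching process is supercritical for small
   h > 0: the extinction probabilities are at most 1 - p g for the first type and
   1 - p g (1 + g) for the second. *)

Require Import Defs.
From HB Require Import structures.
From mathcomp Require Import all_boot all_order all_algebra finmap.
From mathcomp Require Import all_classical all_reals all_analysis.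
From mathcomp Require Import measurable_realfun.
From mathcomp Require Import zify ring lra.

Set Implicit Arguments.
Unset Strict Implicit.
Unset Printing Implicit Defensive.

Import Order.TTheory GRing.Theory Num.Theory.
Import numFieldNormedType.Exports.

Local Open Scope classical_set_scope.
Local Open Scope ring_scope.

(** * Rooted trees *)

(** With the threshold h alone the comparison process is just below critical, as each vertex keeps
    on average slightly less than one child. The type phi > 1 supplies the missing gain: such a
    parent lifts the mean of its child by at least 2 delta. This gain is bounded below before h is
    chosen, whereas the loss is of order h; hence h is picked last. The noises are not identically
    distributed, so every constant must be uniform over the allowed variances, and extinction is
    controlled by a supersolution of its recursion rather than by a fixed point. All estimates are
    made at finite horizons with one constant, and continuity from above then yields infinite
    clusters. [greenR] counts visits without dividing by the degree; this factor reappears only in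
    the covariance of the field. *)

Section RootedTree.
Variables (V : choiceType) (e : rel V) (x0 : V).
Hypothesis tree_e : locally_finite_tree e.

Let e_sym : symmetric e. Proof. by case: tree_e. Qed.
Let e_irr : irreflexive e. Proof. by case: tree_e. Qed.

Lemma walk_from_root z : exists p, path e x0 p /\ last x0 p = z.
Proof. by case: tree_e => _ _ /(_ x0 z I I)[p [? _ ?]] _ _; exists p. Qed.

(** Put in boolean form for [ex_minn], whose minimum is the distance to the root. *)
Lemma walk_lengthP z :
  exists n, `[< exists p, [/\ path e x0 p, last x0 p = z & size p = n] >].
Proof.
have [p [ep pz]] := walk_from_root z.
by exists (size p); apply/asboolP; exists p.
Qed.

Definition depth z : nat := ex_minn (walk_lengthP z).

Lemma depth_walk z :
  exists p, [/\ path e x0 p, last x0 p = z & size p = depth z].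
Proof. by rewrite /depth; case: ex_minnP => n /asboolP. Qed.

Lemma depth_le_size p : path e x0 p -> (depth (last x0 p) <= size p)%N.
Proof.
move=> ep; rewrite /depth; case: ex_minnP => n _; apply.
by apply/asboolP; exists p.
Qed.

Lemma depth_root : depth x0 = 0%N.
Proof. by apply/eqP; rewrite -leqn0; exact: (@depth_le_size [::]). Qed.

Lemma depth_eq0 z : depth z = 0%N -> z = x0.
Proof.
move=> dz; have [p [_ pz]] := depth_walk z.
by rewrite dz => /size0nil p0; rewrite -pz p0.
Qed.

Lemma depth_edge w z : e w z -> (depth z <= (depth w).+1)%N.
Proof.
have [p [ep pw <-]] := depth_walk w => ewz.
rewrite -(size_rcons p z) -[X in depth X](last_rcons x0 p z).
by apply: depth_le_size; rewrite rcons_path ep pw.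
Qed.

(** The part of the walk that ends at z is a walk to z missing at least the last vertex. *)
Lemma depth_lt_geodesic p z : path e x0 p -> size p = depth (last x0 p) ->
  z \in x0 :: p -> z != last x0 p -> (depth z < size p)%N.
Proof.
move=> ep sp zp; case/splitPl: zp ep sp => p1 p2 <-.
rewrite cat_path last_cat size_cat => /andP[ep1 _] _.
have := depth_le_size ep1; case: p2 => [|y p2]; first by rewrite eqxx.
by move=> h _; rewrite /= addnS ltnS (leq_trans h)// leq_addr.
Qed.

(* Two such neighbours a, b are joined by a walk through the root that avoids
   z, which closes up to a simple cycle through z. *)
Lemma unique_lower_neighbor z a b : e z a -> e z b ->
  (depth a <= depth z)%N -> (depth b <= depth z)%N -> a = b.
Proof.
move=> eza ezb az bz; apply/eqP/negPn/negP => ab.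
(* A vertex on a geodesic to c other than c is strictly closer to the root than c, which z is
   not. *)
have avoid c p : e z c -> (depth c <= depth z)%N -> path e x0 p ->
    last x0 p = c -> size p = depth c -> z \notin x0 :: p.
  move=> ezc cz ep pc sp; apply/negP => zp.
  have zc : z != last x0 p.
    by apply: contraTneq ezc => ->; rewrite pc e_irr.
  have := depth_lt_geodesic ep; rewrite pc => /(_ z sp zp).
  by rewrite -pc => /(_ zc); rewrite sp ltnNge cz.
have [pa [epa pa_a spa]] := depth_walk a.
have [pb [epb pb_b spb]] := depth_walk b.
have za := avoid _ _ eza az epa pa_a spa.
have zb := avoid _ _ ezb bz epb pb_b spb.
have erev : path e a (rev (belast x0 pa)).
  rewrite -pa_a rev_path; apply: sub_path epa => u v.
  by rewrite e_sym.
have lrev : last a (rev (belast x0 pa)) = x0.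
  case: pa {epa spa za erev} pa_a => [//|c pa] _.
  by rewrite /= rev_cons last_rcons.
have : path e a (rev (belast x0 pa) ++ pb) by rewrite cat_path erev lrev.
have : last a (rev (belast x0 pa) ++ pb) = b by rewrite last_cat lrev.
have : z \notin a :: rev (belast x0 pa) ++ pb.
  have -> : (z \in a :: rev (belast x0 pa) ++ pb) =
            (z \in x0 :: pa) || (z \in pb).
    by rewrite [x0 :: pa]lastI mem_rcons pa_a !in_cons mem_cat mem_rev orbA.
  by rewrite negb_or za/=; apply: contra zb; rewrite in_cons orbC => ->.
(* A simple walk from a to b closes up through z to a cycle; acyclicity reduces the walk to the
   single vertex a, so b = a. *)
move=> zq lq eq; case/shortenP: eq lq => q' eq' uq' sq' lq.
case: tree_e => _ _ _ /(_ (z :: a :: q')) acyc _.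
have : (size (z :: a :: q') <= 2)%N.
  apply: acyc; first by rewrite /= rcons_path eza eq'/= lq e_sym.
  rewrite cons_uniq uq' andbT; apply: contra zq.
  rewrite !in_cons => /orP[->//|/sq' ->]; by rewrite orbT.
by case: q' lq {eq' uq' sq' acyc} => [/= ab'|//]; rewrite ab' eqxx in ab.
Qed.

(** The default value z of [xget] makes the root its own parent, so that [parent] can be iterated
    without side conditions. *)
Definition parent z : V := xget z [set y | e z y /\ (depth y < depth z)%N].

Lemma parentP z : z != x0 -> e z (parent z) /\ depth z = (depth (parent z)).+1.
Proof.
move=> zx0.
have [p [ep pz sp]] := depth_walk z.
case/lastP: p ep pz sp => [_ /= zx|p y].
  by rewrite zx eqxx in zx0.
rewrite rcons_path last_rcons size_rcons => /andP[ep ey] yz sp; subst y.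
have pe : [set y | e z y /\ (depth y < depth z)%N] (parent z).
  apply: xgetPex; exists (last x0 p); split; first by rewrite e_sym.
  by rewrite -sp ltnS depth_le_size.
case: pe => ezp; rewrite e_sym in ezp => dz; split; first by rewrite e_sym.
by apply/eqP; rewrite eqn_leq dz andbT depth_edge.
Qed.

Lemma parent_root : parent x0 = x0.
Proof. by rewrite /parent xgetPN// => y [_]; rewrite depth_root. Qed.

Lemma parent_eq w z : e z w -> (depth w <= depth z)%N -> z != x0 /\ w = parent z.
Proof.
move=> ezw wz; have zx0 : z != x0.
  apply/eqP => zx; move: wz; rewrite zx depth_root leqn0 => /eqP/depth_eq0 wx.
  by rewrite zx wx e_irr in ezw.
split=> //; have [ezp dz] := parentP zx0.
by apply: (unique_lower_neighbor ezw ezp wz); rewrite dz.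
Qed.

Lemma edge_parent z w : e z w ->
  (z != x0 /\ w = parent z) \/ (w != x0 /\ z = parent w).
Proof.
move=> ezw; have [wz|/ltnW zw] := leqP (depth w) (depth z).
  by left; exact: parent_eq.
by right; apply: parent_eq => //; rewrite e_sym.
Qed.

Lemma is_parentE y x : is_parent e x0 y x <-> x != x0 /\ parent x = y.
Proof.
split=> [[p [[ep gp] py]]|[xx0 <-]].
  move: ep; rewrite rcons_path py => /andP[ep eyx].
  have sp : (size p).+1 = depth x.
    apply/eqP; rewrite eqn_leq -{1}(size_rcons p x); apply/andP; split.
      have [q [eq qx <-]] := depth_walk x; apply: gp => //.
      by rewrite last_rcons.
    rewrite -(size_rcons p x) -[X in depth X](last_rcons x0 p).
    by apply: depth_le_size; rewrite rcons_path ep py.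
  have yx : (depth y <= depth x)%N.
    by rewrite -sp -py ltnW// ltnS; exact: depth_le_size.
  rewrite e_sym in eyx.
  by have [? <-] := parent_eq eyx yx.
have [exp dx] := parentP xx0.
have [p [ep pp sp]] := depth_walk (parent x); exists p; split => //; split.
  by rewrite rcons_path ep pp e_sym.
move=> q eq; rewrite last_rcons => qx.
by rewrite size_rcons sp -dx -qx depth_le_size.
Qed.

Lemma connected_parent (S : set V) z :
  S x0 -> connected_in e S -> S z -> S (parent z).
Proof.
move=> Sx0 cS Sz; have [p [ep Sp pz]] := cS x0 z Sx0 Sz.
suff anc i : S (iter i parent z) by exact: anc 1%N.
elim/last_ind: p ep Sp z pz {Sz} i => [_ Sp z /= <- i|p y IH].
  by elim: i => [//|i IH]; rewrite iterSr parent_root.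
rewrite rcons_path => /andP[ep ey] Sp z.
rewrite last_rcons => <- {z} i.
have Sp' w : w \in x0 :: p -> S w.
  by move=> wp; apply: Sp; rewrite -rcons_cons mem_rcons in_cons wp orbT.
have {}IH := IH ep Sp' _ erefl.
have [[_ ->]|[yx0 yp]] := edge_parent ey; first by rewrite -iterSr; exact: IH.
case: i => [|i]; last by rewrite iterSr -yp; exact: IH.
by apply: Sp; rewrite -rcons_cons mem_rcons in_cons eqxx.
Qed.

Definition below y : set V := [set w | exists i, iter i parent w = y].

Lemma below_refl y : below y y. Proof. by exists 0%N. Qed.

(** This is the separation property that [greenR_separation] asks for: a walk leaves the descendants
    of y only through the edge from y to its parent. *)
Lemma below_edge y w w' : below y w -> e w w' ->
  below y w' \/ w = y /\ w' = parent y.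
Proof.
move=> [i iw] eww'; have [[wx0 ->]|[w'x0 w'w]] := edge_parent eww'.
  case: i iw => [/= <-|i]; first by right.
  by rewrite iterSr; left; exists i.
by left; exists i.+1; rewrite iterSr -w'w.
Qed.

(** Truncated subtraction accounts for the iterates that stay at the root. *)
Lemma depth_iter_parent w i : (depth (iter i parent w) <= depth w - i)%N.
Proof.
elim: i => [|i IH]; first by rewrite subn0.
rewrite iterS; have [->|nx0] := eqVneq (iter i parent w) x0.
  by rewrite parent_root depth_root.
have [_] := parentP nx0; move: IH => /[swap] ->; rewrite subnS; lia.
Qed.

Lemma below_parent y : y != x0 -> ~ below y (parent y).
Proof.
move=> yx0 [i]; rewrite -iterSr => iy.
have := depth_iter_parent y i.+1; rewrite iy.
have [_] := parentP yx0; lia.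
Qed.

(** Going up lowers the depth strictly except at the root, so a nontrivial loop of ancestors forces
    both depths to be 0. *)
Lemma below_anti y z : below y z -> below z y -> y = z.
Proof.
move=> [[//|i] iz] [j jy].
have h1 := depth_iter_parent z i.+1; rewrite iz in h1.
have h2 := depth_iter_parent y j; rewrite jy in h2.
have z0 : depth z = 0%N by lia.
have y0 : depth y = 0%N by lia.
by rewrite (depth_eq0 z0) (depth_eq0 y0).
Qed.

Lemma finite_neighbors x : finite_set (neighbors e x).
Proof. by case: tree_e. Qed.

End RootedTree.

(** * Green's function of a locally finite graph *)

Section PotentialTheory.
Variables (R : realType) (V : choiceType) (e : rel V).

Definition nbrs x : seq V := fset_set (neighbors e x).

Hypothesis finite_nbrs : forall x, finite_set (neighbors e x).
Hypothesis deg_gt0 : forall x, (0 < deg e x)%N.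

Lemma mem_nbrs x y : (y \in nbrs x) = e x y.
Proof. by rewrite /nbrs in_fset_set// mem_setE. Qed.

Lemma uniq_nbrs x : uniq (nbrs x). Proof. exact: fset_uniq. Qed.

Lemma size_nbrs x : size (nbrs x) = deg e x. Proof. by []. Qed.

(** The transition operator of the simple random walk; f is harmonic at x when [avg f x] equals f
    x. *)
Definition avg (f : V -> R) x : R := (deg e x)%:R^-1 * \sum_(z <- nbrs x) f z.

Lemma avg_le f g x : (forall z, e x z -> f z <= g z) -> avg f x <= avg g x.
Proof.
move=> fg; rewrite /avg ler_wpM2l ?invr_ge0// big_seq [leRHS]big_seq.
by apply: ler_sum => z; rewrite mem_nbrs => /fg.
Qed.

Lemma avg_cst c x : avg (fun=> c) x = c.
Proof.
rewrite /avg big_const_seq count_predT size_nbrs iter_addr_0 -(mulr_natr c).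
by rewrite mulrCA mulVf ?mulr1// pnatr_eq0 -lt0n.
Qed.

Lemma avgZ a f x : avg (fun z => a * f z) x = a * avg f x.
Proof. by rewrite /avg -mulr_sumr mulrCA. Qed.

Lemma avgD f g x : avg (fun z => f z + g z) x = avg f x + avg g x.
Proof. by rewrite /avg big_split mulrDr. Qed.

Lemma avg_ge0 f x : (forall z, 0 <= f z) -> 0 <= avg f x.
Proof. by move=> f0; rewrite -(avg_cst 0 x); apply: avg_le => z _. Qed.

Lemma avg_ge_nbr f x z : e x z -> (forall z, 0 <= f z) ->
  (deg e x)%:R^-1 * f z <= avg f x.
Proof.
move=> exz f0; rewrite /avg ler_wpM2l ?invr_ge0//.
rewrite (bigD1_seq z) ?uniq_nbrs ?mem_nbrs//= lerDl.
by rewrite sumr_ge0.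
Qed.

Lemma cvg_avg (f : nat -> V -> R) (l : V -> R) x :
  (forall z, f n z @[n --> \oo] --> l z) ->
  avg (f n) x @[n --> \oo] --> avg l x.
Proof.
move=> fl; apply: cvgM; first exact: cvg_cst.
elim: (nbrs x) => [|z r IH].
  by rewrite big_nil; under eq_fun do rewrite big_nil; exact: cvg_cst.
by rewrite big_cons; under eq_fun do rewrite big_cons; exact: cvgD (fl z) IH.
Qed.

(** The n-step transition probabilities, by conditioning on the first step. *)
Fixpoint trans n x y : R :=
  if n is m.+1 then avg (trans m ^~ y) x else (x == y)%:R.

Lemma trans_ge0 n x y : 0 <= trans n x y.
Proof. by elim: n x => [|n IH] x //=; apply: avg_ge0. Qed.

(** The left side is the share of the walks that are at y at time m. *)
Lemma trans_add m n x y z : trans m x y * trans n y z <= trans (m + n) x z.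
Proof.
elim: m x => [|m IH] x.
  rewrite add0n /=; case: eqP => [->|_]; first by rewrite mul1r.
  by rewrite mul0r trans_ge0.
rewrite addSn /= mulrC -avgZ; apply: avg_le => w _.
by rewrite mulrC IH.
Qed.

Lemma trans_path x p : path e x p -> 0 < trans (size p) x (last x p).
Proof.
elim: p x => [x _|y p IH x] /=; first by rewrite eqxx.
case/andP => exy ep; have h : forall z, 0 <= trans (size p) z (last y p).
  by move=> z; exact: trans_ge0.
apply: lt_le_trans (avg_ge_nbr exy h).
by rewrite mulr_gt0 ?IH// invr_gt0 ltr0n.
Qed.

Definition greenN n x y : R := \sum_(k < n) trans k x y.

Lemma greenNS n x y : greenN n.+1 x y = (x == y)%:R + avg (greenN n ^~ y) x.
Proof.
rewrite /greenN big_ord_recl /=; congr (_ + _).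
by rewrite /avg exchange_big/= mulr_sumr.
Qed.

Lemma greenN_ge0 n x y : 0 <= greenN n x y.
Proof. by apply: sumr_ge0 => k _; exact: trans_ge0. Qed.

Lemma greenN_nd x y : nondecreasing_seq (fun n => greenN n x y).
Proof.
apply/nondecreasing_seqP => n.
by rewrite /greenN big_ord_recr /= lerDl trans_ge0.
Qed.

(** Iterating the first-step identity [greenNS] from 0 never rises above a supersolution. *)
Lemma greenN_le_superharmonic (v : V -> R) y : (forall x, 0 <= v x) ->
  (forall x, (x == y)%:R + avg v x <= v x) -> forall n x, greenN n x y <= v x.
Proof.
move=> v0 vP; elim=> [|n IH] x; first by rewrite /greenN big_ord0.
by rewrite greenNS; apply: le_trans (vP x); rewrite lerD2l avg_le.
Qed.

(** Each visit to y produces, m steps later, a visit to z with probability [trans m y z].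
    Boundedness at a single pole thus spreads to every pole from which it can be reached. *)
Lemma greenN_bounded_trans B x y z m : 0 < trans m y z ->
  (forall n, greenN n x z <= B) -> exists B', forall n, greenN n x y <= B'.
Proof.
move=> t0 h; exists (B / trans m y z) => n; rewrite ler_pdivlMr//.
apply: le_trans (h (m + n)%N); rewrite /greenN mulr_suml.
rewrite -(big_mkord xpredT (fun k => trans k x z)) (big_cat_nat _ (leq_addr n m))//=.
rewrite (_ : \sum_(m <= i < m + n) trans i x z = \sum_(k < n) trans (k + m) x z).
  rewrite -[leLHS]add0r lerD ?sumr_ge0// => [k _|]; first exact: trans_ge0.
  by apply: ler_sum => k _; exact: trans_add.
by rewrite -{1}[m]add0n big_addn addKn big_mkord.
Qed.

Hypothesis greenN_bounded : forall x y, exists B, forall n, greenN n x y <= B.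

Definition greenR x y : R := limn (fun n => greenN n x y).

Lemma greenN_cvg x y : greenN n x y @[n --> \oo] --> greenR x y.
Proof.
apply: nondecreasing_is_cvgn; first exact: greenN_nd.
by have [B hB] := greenN_bounded x y; exists B => _ [n _ <-].
Qed.

Lemma greenN_le n x y : greenN n x y <= greenR x y.
Proof.
apply: nondecreasing_cvgn_le; first exact: greenN_nd.
by apply/cvg_ex; exists (greenR x y); exact: greenN_cvg.
Qed.

Lemma greenR_le x y B : (forall n, greenN n x y <= B) -> greenR x y <= B.
Proof.
move=> h; apply: limr_le; last by near=> n; exact: h.
by apply/cvg_ex; exists (greenR x y); exact: greenN_cvg.
Unshelve. all: by end_near. Qed.

Lemma greenR_ge0 x y : 0 <= greenR x y.
Proof. exact: le_trans (greenN_ge0 0 x y) (greenN_le 0 x y). Qed.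

Lemma greenRE x y : greenR x y = (x == y)%:R + avg (greenR ^~ y) x.
Proof.
have h1 : greenN n.+1 x y @[n --> \oo] --> greenR x y.
  by have := @greenN_cvg x y; rewrite -(cvg_shiftS (fun n => greenN n x y)).
have h2 : greenN n.+1 x y @[n --> \oo] --> (x == y)%:R + avg (greenR ^~ y) x.
  under eq_fun do rewrite greenNS.
  apply: cvgD; first exact: cvg_cst.
  by apply: cvg_avg => z; exact: greenN_cvg.
exact: cvg_unique h1 h2.
Qed.

Lemma greenR_harmonic x y : x != y -> greenR x y = avg (greenR ^~ y) x.
Proof. by move=> /negbTE xy; rewrite greenRE xy add0r. Qed.

Lemma greenR_diag_ge1 x : 1 <= greenR x x.
Proof.
by rewrite greenRE eqxx lerDl avg_ge0// => z; exact: greenR_ge0.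
Qed.

Lemma greenR_diag_gt0 x : 0 < greenR x x.
Proof. exact: lt_le_trans ltr01 (greenR_diag_ge1 x). Qed.

Lemma greenR_nbr_ge x y : e x y -> (deg e x)%:R^-1 * greenR y y <= greenR x y.
Proof.
move=> exy; rewrite [leRHS]greenRE.
apply: le_trans (avg_ge_nbr exy (fun z => greenR_ge0 z y)) _.
by rewrite lerDr.
Qed.

(* Both sides, as functions of w, agree at x and are superharmonic, the left
   one harmonically off x. *)
Lemma greenR_triangle x w y :
  greenR w x * greenR x y <= greenR w y * greenR x x.
Proof.
(* The partial sums start from 0, so induction on the time horizon replaces the minimum
   principle. *)
have h n w' : greenN n w' x * greenR x y <= greenR w' y * greenR x x.
  elim: n w' => [|n IH] w'.
    by rewrite /greenN big_ord0 mul0r mulr_ge0// greenR_ge0.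
  have [->|wx] := eqVneq w' x.
    by rewrite mulrC ler_wpM2l ?greenR_ge0// greenN_le.
  rewrite greenNS (negbTE wx) add0r (greenRE w' y) mulrDl.
  rewrite -[leLHS]add0r lerD ?mulr_ge0 ?greenR_ge0//.
  rewrite mulrC [leRHS]mulrC -!avgZ; apply: avg_le => z _.
  by rewrite mulrC [leRHS]mulrC.
have [->|n0] := eqVneq (greenR x y) 0.
  by rewrite mulr0 mulr_ge0 ?greenR_ge0.
have p0 : 0 < greenR x y by rewrite lt_def n0 greenR_ge0.
by rewrite -ler_pdivlMr//; apply: greenR_le => n; rewrite ler_pdivlMr.
Qed.

(** The right side is Green's function at w of the walk killed at x, and the visit at time 0 already
    counts for 1. The function k below is nonnegative by [greenR_triangle] and satisfies the
    first-step equation at w. *)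
Lemma greenR_killed_ge w x : e w x -> w != x ->
  1 <= greenR w w - greenR w x * greenR x w / greenR x x.
Proof.
move=> ewx wx; pose k z := greenR z w - greenR z x * greenR x w / greenR x x.
have k0 z : 0 <= k z.
  rewrite subr_ge0 ler_pdivrMr ?greenR_diag_gt0//.
  exact: greenR_triangle.
rewrite -/(k w) (_ : k w = 1 + avg k w) ?lerDl ?avg_ge0//.
rewrite /k [in LHS]greenRE eqxx (greenR_harmonic wx) -addrA; congr (1 + _).
rewrite [RHS](_ : _ = avg (fun z => greenR z w +
    (- (greenR x w / greenR x x)) * greenR z x) w).
  by rewrite avgD avgZ; ring.
by congr (avg _ _); apply/funext => z; ring.
Qed.

(* The only edge leaving A starts at y and ends at x, so the values on A are
   determined by the value at x. *)
Lemma greenR_separation (A : set V) x z1 z2 w :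
  (forall u v, A u -> e u v -> A v \/ v = x) -> ~ A z1 -> ~ A z2 -> A w ->
  greenR w z1 * greenR x z2 = greenR w z2 * greenR x z1.
Proof.
move=> bdA; suff h z1' z2' : ~ A z1' -> ~ A z2' -> A w ->
    greenR w z1' * greenR x z2' <= greenR w z2' * greenR x z1'.
  by move=> A1 A2 Aw; apply/eqP; rewrite eq_le !h.
move=> A1 A2.
(* The induction includes x because a step out of A lands there. *)
have h n v : A v \/ v = x ->
    greenN n v z1' * greenR x z2' <= greenR v z2' * greenR x z1'.
  elim: n v => [|n IH] v Av.
    by rewrite /greenN big_ord0 mul0r mulr_ge0// greenR_ge0.
  have [->|wx] := eqVneq v x.
    by rewrite mulrC ler_wpM2l ?greenR_ge0// greenN_le.
  case: Av => [Av|vx']; last by rewrite vx' eqxx in wx.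
  have /negbTE w1 : v != z1' by apply/eqP => wz; rewrite wz in Av.
  have w2 : v != z2' by apply/eqP => wz; rewrite wz in Av.
  rewrite greenNS w1 add0r (greenR_harmonic w2).
  rewrite mulrC [leRHS]mulrC -!avgZ; apply: avg_le => z evz.
  by rewrite mulrC [leRHS]mulrC; apply: IH; exact: bdA Av evz.
move=> Aw.
have [->|n0] := eqVneq (greenR x z2') 0.
  by rewrite mulr0 mulr_ge0 ?greenR_ge0.
have p0 : 0 < greenR x z2' by rewrite lt_def n0 greenR_ge0.
rewrite -ler_pdivlMr//; apply: greenR_le => n; rewrite ler_pdivlMr//.
by apply: h; left.
Qed.

End PotentialTheory.

(** * Transience from a binary sub-tree *)

Section BinarySubtree.
Variables (R : realType) (V : choiceType) (e : rel V) (x0 : V).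
Hypothesis tree_e : locally_finite_tree e.
Variable S : set V.
Hypothesis binary_S : binary_subtree e x0 S.

Local Notation parent := (parent x0 tree_e).
Local Notation depth := (depth x0 tree_e).

Let e_sym : symmetric e. Proof. by case: tree_e. Qed.
Let Sx0 : S x0. Proof. by case: binary_S. Qed.
Let S_parent z : S z -> S (parent z).
Proof. by case: binary_S => ? ? _; exact: connected_parent. Qed.
Let fin_nbrs := finite_neighbors tree_e.

Lemma children_sub_neighbors x : children e x0 x `<=` neighbors e x.
Proof.
move=> y /(is_parentE x0 tree_e)[yx0 <-]; rewrite /neighbors/= e_sym.
by have [] := parentP tree_e yx0.
Qed.

Lemma two_children y : S y -> exists c1 c2, [/\ c1 != c2,
  S c1 /\ S c2, c1 != x0 /\ c2 != x0 & parent c1 = y /\ parent c2 = y].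
Proof.
case: binary_S => _ _ /[apply] /eqP.
set F := fset_set _; have memF z : z \in (F : seq V) -> [/\ S z, z != x0 & parent z = y].
  rewrite -[z \in _]/(z \in F) in_fset_set.
    by rewrite inE => -[/(is_parentE x0 tree_e)[? ?] ?].
  apply: sub_finite_set (fin_nbrs y).
  by move=> t [/children_sub_neighbors].
have : uniq F by [].
move: memF; case: (F : seq V) => [//|c1 [//|c2 [|//]]] memF.
rewrite /= inE andbT => c12 _.
have := memF c1; rewrite !inE eqxx => /(_ isT)[? ? ?].
have := memF c2; rewrite !inE eqxx orbT => /(_ isT)[? ? ?].
by exists c1, c2.
Qed.

Lemma deg_gt0 x : (0 < deg e x)%N.
Proof.
rewrite -size_nbrs; suff [y exy] : exists y, e x y.
  have : y \in nbrs e x by rewrite mem_nbrs.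
  by case: (nbrs e x).
have [->|xx0] := eqVneq x x0.
  have [c1 [_ [_ _ [c1x0 _] [<- _]]]] := two_children Sx0.
  by exists c1; rewrite e_sym; have [] := parentP tree_e c1x0.
by exists (parent x); have [] := parentP tree_e xx0.
Qed.

Definition branch_depth z : nat :=
  \sum_(i < depth z) (iter i parent z \in S).

(* Superharmonic: at a vertex of S the two children in S lose together what the
   parent gains. *)
Definition branch_weight z : R := 2^-1 ^+ branch_depth z.

Lemma branch_depth_parent z : z != x0 ->
  branch_depth z = ((z \in S) + branch_depth (parent z))%N.
Proof.
move=> zx0; have [_ dz] := parentP tree_e zx0.
rewrite /branch_depth dz big_ord_recl /=; congr addn.
by apply: eq_bigr => i _; rewrite -iterSr.
Qed.

Lemma branch_weight_gt0 z : 0 < branch_weight z.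
Proof. by rewrite exprn_gt0. Qed.

Lemma branch_weight_ge0 z : 0 <= branch_weight z.
Proof. exact: ltW (branch_weight_gt0 z). Qed.

Lemma branch_weight_in z : z != x0 -> S z ->
  branch_weight z = 2^-1 * branch_weight (parent z).
Proof.
move=> zx0 Sz; rewrite /branch_weight branch_depth_parent//.
by rewrite (mem_set Sz) add1n exprS.
Qed.

Lemma branch_weight_out z : ~ S z -> branch_weight z = branch_weight (parent z).
Proof.
move=> Sz; have zx0 : z != x0 by apply/eqP => zx; apply: Sz; rewrite zx.
by rewrite /branch_weight branch_depth_parent// memNset.
Qed.

Lemma branch_weight_nbr y z : e y z -> z != parent y ->
  branch_weight z <= branch_weight y.
Proof.
move=> eyz; case: (edge_parent x0 tree_e eyz) => [[_ ->]|[zx0 ->] _].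
  by rewrite eqxx.
have [Sz|Sz] := pselect (S z); last by rewrite branch_weight_out.
rewrite branch_weight_in// ler_piMl ?branch_weight_ge0//.
lra.
Qed.

Lemma sum_seq_indicator (T : eqType) (s : seq T) c : uniq s ->
  \sum_(z <- s) (z == c)%:R = (c \in s)%:R :> R.
Proof.
by move=> us; rewrite -natr_sum -big_mkcond sum1_count (count_uniq_mem c us).
Qed.

Lemma avg_branch_weight_le w : avg e branch_weight w <= branch_weight w.
Proof.
(* Off S the weight is constant on w and its neighbours: the parent of w has the weight of w, and no
   child of w lies in S since S is closed under parents. *)
have [Sw|Sw] := pselect (S w); last first.
  rewrite -[leRHS](avg_cst deg_gt0 _ w); apply: avg_le => // z ewz.
  case: (edge_parent x0 tree_e ewz) => [[_ ->]|[zx0 wz]].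
    by rewrite -branch_weight_out.
  by rewrite wz branch_weight_out// => /S_parent; rewrite -wz.
have [c1 [c2 [c12 [S1 S2] [c1x0 c2x0] [p1 p2]]]] := two_children Sw.
have e1 : e w c1 by rewrite e_sym -p1; have [] := parentP tree_e c1x0.
have e2 : e w c2 by rewrite e_sym -p2; have [] := parentP tree_e c2x0.
rewrite /avg mulrC ler_pdivrMr ?ltr0n ?deg_gt0//.
(* [b] bounds the ratio of the weight of z to that of w: 2 at the parent, 1/2 at the two children in
   S, 1 elsewhere. *)
pose b z : R := 1 + (z == parent w)%:R - 2^-1 * (z == c1)%:R -
  2^-1 * (z == c2)%:R.
apply: (@le_trans _ _ (\sum_(z <- nbrs e w) branch_weight w * b z)).
  rewrite big_seq [leRHS]big_seq; apply: ler_sum => z.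
  rewrite mem_nbrs// => ewz; rewrite /b.
  have [->|zc1] := eqVneq z c1.
    rewrite (negbTE c12) (branch_weight_in c1x0)// p1 mulr0 subr0 mulrC.
    rewrite ler_wpM2l ?branch_weight_ge0//.
    by case: (_ == parent w) => /=; lra.
  have [->|zc2] := eqVneq z c2.
    rewrite (branch_weight_in c2x0)// p2 mulr0 subr0 mulrC.
    rewrite ler_wpM2l ?branch_weight_ge0//.
    by case: (_ == parent w) => /=; lra.
  rewrite !mulr0 !subr0; have [zp|zp] := eqVneq z (parent w); last first.
    by rewrite addr0 mulr1 branch_weight_nbr.
  have wx0 : w != x0.
    apply/eqP => wx; move: ewz; rewrite zp wx parent_root.
    by case: tree_e => _ ->.
  by have := branch_weight_in wx0 Sw; rewrite zp /=; lra.
rewrite -mulr_sumr ler_wpM2l ?branch_weight_ge0//.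
rewrite /b !big_split/= !sumrN -!mulr_sumr !sum_seq_indicator ?uniq_nbrs//.
rewrite !mem_nbrs// e1 e2 big_const_seq count_predT size_nbrs iter_addr_0.
by case: (e w (parent w)) => /=; lra.
Qed.

(** Truncation removes the excess of the parent, while the two children in S still lose half of the
    weight each. The total deficit is one full weight of y, shared among deg y neighbours. *)
Lemma avg_min_branch_weight y : S y ->
  (deg e y)%:R^-1 * branch_weight y +
    avg e (fun z => Num.min (branch_weight z) (branch_weight y)) y <=
  branch_weight y.
Proof.
move=> Sy; have [c1 [c2 [c12 [S1 S2] [c1x0 c2x0] [p1 p2]]]] := two_children Sy.
have e1 : e y c1 by rewrite e_sym -p1; have [] := parentP tree_e c1x0.
have e2 : e y c2 by rewrite e_sym -p2; have [] := parentP tree_e c2x0.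
rewrite /avg -mulrDr mulrC ler_pdivrMr ?ltr0n ?deg_gt0//.
pose b z : R := 1 - 2^-1 * (z == c1)%:R - 2^-1 * (z == c2)%:R.
have hb : \sum_(z <- nbrs e y) Num.min (branch_weight z) (branch_weight y) <=
    \sum_(z <- nbrs e y) branch_weight y * b z.
  rewrite big_seq [leRHS]big_seq; apply: ler_sum => z.
  rewrite mem_nbrs// => ewz; rewrite /b ge_min.
  have [->|zc1] := eqVneq z c1.
    rewrite (negbTE c12) (branch_weight_in c1x0)// p1; apply/orP; left => /=; lra.
  have [->|zc2] := eqVneq z c2.
    rewrite (branch_weight_in c2x0)// p2; apply/orP; left => /=; lra.
  by apply/orP; right => /=; lra.
apply: le_trans (lerD (lexx _) hb) _.
rewrite -mulr_sumr.
rewrite /b !big_split/= !sumrN -!mulr_sumr !sum_seq_indicator ?uniq_nbrs//.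
rewrite !mem_nbrs// e1 e2 big_const_seq count_predT size_nbrs iter_addr_0.
rewrite -{1}[branch_weight y]mulr1 -mulrDr.
by rewrite ler_wpM2l ?branch_weight_ge0//=; lra.
Qed.

Lemma greenN_le_deg n x y : S y -> greenN R e n x y <= (deg e y)%:R.
Proof.
move=> Sy; pose u := branch_weight.
(* Scaled so that the deficit of the average at y becomes 1; the value at y, which is the maximum,
   is then deg y. *)
pose v z : R := (deg e y)%:R / u y * Num.min (u z) (u y).
have d0 : 0 < (deg e y)%:R :> R by rewrite ltr0n deg_gt0.
have uy0 : 0 < u y := branch_weight_gt0 y.
have c0 : 0 < (deg e y)%:R / u y by rewrite divr_gt0.
have vP z : (z == y)%:R + avg e v z <= v z.
  rewrite /v avgZ; have [->|zy] := eqVneq z y.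
    rewrite minxx.
    have := avg_min_branch_weight Sy; rewrite -/u -(ler_pM2l c0).
    apply: le_trans; rewrite mulrDr lerD2r.
    by rewrite mulrACA divff ?gt_eqF// mulVf ?gt_eqF// mulr1.
  (* Away from y, v is a multiple of the minimum of two superharmonic functions, one of them
     constant. *)
  rewrite add0r ler_pM2l// le_min; apply/andP; split.
    apply: le_trans (avg_branch_weight_le z); apply: avg_le => // w _.
    by rewrite ge_min lexx.
  rewrite -[leRHS](avg_cst deg_gt0 _ z); apply: avg_le => // w _.
  by rewrite ge_min lexx orbT.
have v0 z : 0 <= v z by rewrite mulr_ge0 ?(ltW c0)// le_min !branch_weight_ge0.
apply: le_trans (greenN_le_superharmonic fin_nbrs v0 vP n x) _.
rewrite /v -[leRHS]mulr1 -mulrA ler_pM2l// ler_pdivrMl//.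
by rewrite mulr1 ge_min lexx orbT.
Qed.

(** From y the walk reaches x0 with positive probability, and the pole x0 lies in S. *)
Lemma greenN_bounded x y : exists B, forall n, greenN R e n x y <= B.
Proof.
case: tree_e => _ _ /(_ y x0 I I)[p [ep _ py]] _ _.
have := trans_path R fin_nbrs deg_gt0 ep; rewrite py => t0.
apply: (greenN_bounded_trans fin_nbrs deg_gt0 t0) => n.
exact: (greenN_le_deg n x Sx0).
Qed.

Lemma greenR_le_deg x y : S y -> greenR R e x y <= (deg e y)%:R.
Proof.
by move=> Sy; apply: (greenR_le fin_nbrs deg_gt0 greenN_bounded) => n; exact: greenN_le_deg.
Qed.

Lemma deg_le_nb_children y : (deg e y <= (nb_children e x0 y).+1)%N.
Proof.
have fc : finite_set (children e x0 y).
  exact: sub_finite_set (@children_sub_neighbors y) (fin_nbrs y).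
have := size_rcons (fset_set (children e x0 y)) (parent y).
rewrite -size_nbrs /nb_children => <-.
rewrite uniq_leq_size ?uniq_nbrs// => z.
rewrite mem_nbrs// mem_rcons in_cons => eyz.
case: (edge_parent x0 tree_e eyz) => [[_ ->]|[zx0 yz]]; first by rewrite eqxx.
rewrite -[z \in enum_fset _]/(z \in fset_set (children e x0 y)) in_fset_set//.
by apply/orP; right; apply/mem_set/is_parentE.
Qed.

End BinarySubtree.

(** * Simple random walk *)

Lemma probability_setI1 d (T : measurableType d) (R : realType)
    (P : probability T R) (A B : set T) : measurable A -> measurable B ->
  P A = 1%E -> P (A `&` B) = P B.
Proof.
move=> mA mB PA; have h : P (~` A `&` B) = 0%E.
  apply/eqP; rewrite -measure_le0 (@le_trans _ _ (P (~` A)))//.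
    by rewrite le_measure ?inE//; [apply: measurableI => //; exact: measurableC
                                  |exact: measurableC].
  by rewrite probability_setC// PA subee.
rewrite -[in RHS](setTI B) -(setUv A) setIUl measureU//; last first.
- by rewrite setIACA setICr set0I.
- by apply: measurableI => //; exact: measurableC.
- exact: measurableI.
by rewrite [X in (_ + X)%E](_ : _ = 0%E) ?adde0//; exact: h.
Qed.

Section RandomWalk.
Variables (R : realType) (V : choiceType) (e : rel V).
Hypothesis finite_nbrs : forall x, finite_set (neighbors e x).
Hypothesis deg_gt0 : forall x, (0 < deg e x)%N.
Variables (d : measure_display) (W : measurableType d).
Variables (P : V -> probability W R) (X : nat -> W -> V).
Hypothesis srw_X : is_srw e P X.

Local Notation nbrs := (nbrs e).
Local Notation avg := (avg e).
Local Notation trans := (trans R e).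
Local Notation greenN := (greenN R e).
Local Notation greenR := (greenR R e).

Let mX k y : measurable (X k @^-1` [set y]). Proof. by case: srw_X. Qed.

Definition trajectory x p : set W := [set w | mkseq (X ^~ w) (size p).+1 = x :: p].

Definition path_weight x p : R := \prod_(r <- pairmap (srw_step R e) x p) r.

Lemma trajectory_nil x : trajectory x [::] = X 0 @^-1` [set x].
Proof.
by apply/seteqP; split => w; rewrite /trajectory/mkseq/=; [case|move=> ->].
Qed.

Lemma trajectory_rcons x p z :
  trajectory x (rcons p z) = trajectory x p `&` X (size p).+1 @^-1` [set z].
Proof.
apply/seteqP; split => w; rewrite /trajectory/= size_rcons (mkseqS _ (size p).+1) -rcons_cons.
  by move=> /eqP; rewrite eqseq_rcons => /andP[/eqP-> /eqP->].
by move=> [-> ->].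
Qed.

Lemma measurable_trajectory x p : measurable (trajectory x p).
Proof.
elim/last_ind: p => [|p z IH]; first by rewrite trajectory_nil.
by rewrite trajectory_rcons; exact: measurableI.
Qed.

Lemma probability_trajectory x p : P x (trajectory x p) = (path_weight x p)%:E.
Proof. by case: srw_X => _ ->. Qed.

Lemma path_weight_rcons x p z :
  path_weight x (rcons p z) = path_weight x p * srw_step R e (last x p) z.
Proof.
by rewrite /path_weight -cats1 pairmap_cat big_cat/= big_seq1.
Qed.

Lemma path_weight_ge0 x p : 0 <= path_weight x p.
Proof. by rewrite -lee_fin -probability_trajectory. Qed.

Lemma sum_path_weight x p f :
  \sum_(z <- nbrs (last x p)) path_weight x (rcons p z) * f z =
  path_weight x p * avg f (last x p).
Proof.
rewrite /avg mulrA mulr_sumr big_seq [RHS]big_seq; apply: eq_bigr => z.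
by rewrite mem_nbrs// path_weight_rcons /srw_step => ->.
Qed.

(** The event is split according to the next vertex. Only the finitely many neighbours matter, so no
    countability of V is required. *)
Lemma srw_one_step x p A : measurable A ->
  P x (trajectory x p `&` A) =
  (\sum_(z <- nbrs (last x p)) P x (trajectory x (rcons p z) `&` A))%E.
Proof.
have mt := measurable_trajectory.
pose D := neighbors e (last x p).
have fD : finite_set D by exact: finite_nbrs.
pose U B := \bigcup_(z in D) (trajectory x (rcons p z) `&` B).
have mU B : measurable B -> measurable (U B).
  by move=> mB; apply: (fin_bigcup_measurable fD) => z _; exact: measurableI.
have PU B : measurable B -> P x (U B) =
    (\sum_(z <- nbrs (last x p)) P x (trajectory x (rcons p z) `&` B))%E.
  move=> mB; rewrite /U measure_fin_bigcup//.
  - by rewrite fsbig_finite.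
  - apply/trivIsetP => z z' _ _ zz'; apply/seteqP; split => // w [[]].
    rewrite !trajectory_rcons => -[_ /= wz] _ [[_ /= wz'] _].
    by rewrite -wz -wz' eqxx in zz'.
  - by move=> z _; exact: measurableI.
have Usub B : U B `<=` trajectory x p `&` B.
  by move=> w [z _ [+ Bw]]; rewrite trajectory_rcons => -[].
(* The extensions to neighbours already exhaust the weight of the trajectory, so moving to any other
   vertex has probability 0. *)
have rest0 : P x (trajectory x p `\` U setT) = 0%E.
  have : (P x (trajectory x p) =
      P x (trajectory x p `\` U setT) + P x (trajectory x p `&` U setT))%E.
    exact: measureDI (mt x p) (mU setT measurableT).
  rewrite (setIidr _); last by apply: subset_trans (@Usub setT) _ => w [].
  rewrite PU// probability_trajectory.
  under eq_bigr do rewrite setIT probability_trajectory -[path_weight _ _]mulr1.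
  rewrite sumEFin (sum_path_weight x p (fun=> 1)) avg_cst// mulr1.
  move/(congr1 (fun t => t - (path_weight x p)%:E)%E).
  by rewrite subee// addeK.
move=> mA; rewrite -PU//.
have -> : trajectory x p `&` A = U A `|` ((trajectory x p `\` U setT) `&` A).
  apply/seteqP; split => [w [tw Aw]|w [/Usub//|[[]]//]].
  have [Uw|Uw] := pselect (U setT w); last by right.
  by left; case: Uw => z Dz [tz _]; exists z.
rewrite measureU//.
- rewrite [X in (_ + X)%E](_ : _ = 0%E) ?adde0//.
  apply/eqP; rewrite -measure_le0 -rest0 le_measure ?inE//.
  + by apply: measurableI => //; apply: measurableD => //; exact: mU.
  + by apply: measurableD => //; exact: mU.
- exact: mU.
- by apply: measurableI => //; apply: measurableD => //; exact: mU.
- apply/seteqP; split => // w [[z Dz [tz _]] [[_ Uw] _]].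
  by apply: Uw; exists z.
Qed.

Lemma srw_marginal_trajectory x y k p :
  P x (trajectory x p `&` X (size p + k) @^-1` [set y]) =
  (path_weight x p * trans k (last x p) y)%:E.
Proof.
elim: k p => [|k IH] p.
  rewrite addn0 /=; have [<-|/eqP ly] := eqVneq (last x p) y.
    rewrite mulr1 -probability_trajectory; congr (P x _).
    apply/setIidl => w; rewrite /trajectory/= => tw.
    have := congr1 (fun s => nth x s (size p)) tw.
    by rewrite nth_mkseq// nth_last.
  rewrite mulr0 (_ : _ `&` _ = set0) ?measure0//.
  apply/seteqP; split => // w []; rewrite /trajectory/= => tw wy; apply: ly.
  have := congr1 (fun s => nth x s (size p)) tw.
  by rewrite nth_mkseq// (nth_last x (x :: p))/= wy.
rewrite srw_one_step//=.
under eq_bigr => z _.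
  rewrite addnS -addSn -(size_rcons p z) IH last_rcons; over.
by rewrite sumEFin (sum_path_weight x p (fun z => trans k z y)).
Qed.

Lemma trajectory_start x : P x (trajectory x [::]) = 1%E.
Proof. by rewrite probability_trajectory /path_weight big_nil. Qed.

Lemma srw_marginal x y k : P x (X k @^-1` [set y]) = (trans k x y)%:E.
Proof.
rewrite -(probability_setI1 (measurable_trajectory x [::]) _ (trajectory_start x))//.
by rewrite (srw_marginal_trajectory x y k [::]) /path_weight big_nil mul1r.
Qed.

(** A function superharmonic off y and at least 1 at y dominates the probability of hitting y; the
    finite horizon n turns the optional stopping argument into an induction. *)
Lemma srw_hit_le x y v n p : (forall z, 0 <= v z) -> 1 <= v y ->
    (forall z, z != y -> avg v z <= v z) ->
  (P x (trajectory x p `&`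
     [set w | exists j, (j <= n)%N /\ X (size p + j) w = y]) <=
   (path_weight x p * v (last x p))%:E)%E.
Proof.
move=> v0 vy vP.
have mh m i : measurable [set w | exists j, (j <= m)%N /\ X (i + j) w = y].
  rewrite (_ : [set w | _] =
      \bigcup_(j in [set j | (j <= m)%N]) (X (i + j) @^-1` [set y])).
    by apply: bigcup_measurable.
  by apply/seteqP; split => w [j /=]; [case=> jm jy; exists j|exists j].
have mt := measurable_trajectory.
elim: n p => [|n IH] p; have [lp|lp] := eqVneq (last x p) y.
- apply: (@le_trans _ _ (P x (trajectory x p))).
    by rewrite le_measure ?inE//; exact: measurableI.
  by rewrite probability_trajectory lee_fin ler_peMr ?path_weight_ge0// lp.
- rewrite (_ : _ `&` _ = set0) ?measure0 ?lee_fin ?mulr_ge0 ?path_weight_ge0//.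
  apply/seteqP; split => // w []; rewrite /trajectory/= => tw [j []].
  rewrite leqn0 => /eqP ->; rewrite addn0 => wy; move/eqP: lp; apply.
  have := congr1 (fun s => nth x s (size p)) tw.
  by rewrite nth_mkseq// (nth_last x (x :: p))/= wy.
- apply: (@le_trans _ _ (P x (trajectory x p))).
    by rewrite le_measure ?inE//; exact: measurableI.
  by rewrite probability_trajectory lee_fin ler_peMr ?path_weight_ge0// lp.
rewrite srw_one_step//.
apply: (@le_trans _ _ (\sum_(z <- nbrs (last x p))
    (path_weight x (rcons p z) * v z)%:E)%E); last first.
  by rewrite sumEFin sum_path_weight lee_fin ler_wpM2l ?path_weight_ge0// vP.
apply: lee_sum => z _.
have := IH (rcons p z); rewrite last_rcons; apply: le_trans.
rewrite le_measure ?inE//; try exact: measurableI.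
move=> w [tw [j [jn jy]]]; split => //.
move: tw; rewrite /trajectory/= => tw.
case: j jn jy => [_|j jn jy]; last by exists j; rewrite size_rcons addSnnS.
rewrite addn0 => wy; exfalso; move/eqP: lp; apply.
have := congr1 (fun s => nth x s (size p)) tw.
rewrite nth_mkseq ?size_rcons// -rcons_cons nth_rcons/= ltnSn.
by rewrite (nth_last x (x :: p))/= wy.
Qed.

Hypothesis greenN_bounded : forall x y, exists B, forall n, greenN n x y <= B.

Lemma srw_transient : transient P X.
Proof.
(* v is the probability of ever hitting x from z, and its average at x bounds the probability of
   return. *)
move=> x; pose v z := greenR z x / greenR x x.
have gx := greenR_diag_gt0 finite_nbrs deg_gt0 greenN_bounded x.
have g0 := greenR_ge0 finite_nbrs deg_gt0 greenN_bounded.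
have v0 z : 0 <= v z by rewrite divr_ge0.
have vx : 1 <= v x by rewrite /v divff ?gt_eqF.
have vE z : avg v z = (greenR x x)^-1 * avg (fun z => greenR z x) z.
  by rewrite -avgZ; congr (avg _ _); apply/funext => t; rewrite mulrC.
have vP z : z != x -> avg v z <= v z.
  move=> zx; rewrite vE /v.
  by rewrite (greenR_harmonic finite_nbrs deg_gt0 greenN_bounded zx) mulrC.
pose A n := [set w | exists k, [/\ (0 < k)%N, (k <= n.+1)%N & X k w = x]].
have mA n : measurable (A n).
  rewrite (_ : A n =
      \bigcup_(j in [set j | (0 < j <= n.+1)%N]) (X j @^-1` [set x])).
    by apply: bigcup_measurable.
  apply/seteqP; split => w [j /=]; first by case=> j0 jn jy; exists j => //=; rewrite j0.
  by move=> /andP[j0 jn] jy; exists j.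
have -> : [set w | exists k, (0 < k)%N /\ X k w = x] = \bigcup_n A n.
  apply/seteqP; split => [w [k [k0 kx]]|w [n _ [k [k0 _ kx]]]].
    by exists k => //; exists k; split => //; exact: ltnW.
  by exists k.
have Abd n : (P x (A n) <= (avg v x)%:E)%E.
  rewrite -(probability_setI1 (measurable_trajectory x [::]) _ (trajectory_start x))//.
  rewrite srw_one_step//=.
  have := sum_path_weight x [::] v; rewrite /path_weight/= big_nil mul1r => <-.
  rewrite -sumEFin; apply: lee_sum => z _.
  have := srw_hit_le x n [:: z] v0 vx vP.
  apply: le_trans; apply: le_measure; rewrite ?inE.
  - by apply: measurableI => //; exact: measurable_trajectory.
  - apply: measurableI; first exact: measurable_trajectory.
    rewrite (_ : [set w | _] =
      \bigcup_(j in [set j | (j <= n)%N]) (X (1 + j) @^-1` [set x])).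
      by apply: bigcup_measurable.
    by apply/seteqP; split => w [j /=]; [case=> jm jy; exists j|exists j].
  move=> w [tw [k [k0 kn kx]]]; split => //.
  by case: k k0 kn kx => // k _ kn kx; exists k.
apply: (@le_lt_trans _ _ (avg v x)%:E).
  have nd : nondecreasing_seq A.
    apply/nondecreasing_seqP => n; apply/subsetPset => w [k [k0 kn kx]].
    by exists k; split => //; exact: leqW.
  have cv : P x (A n) @[n --> \oo] --> P x (\bigcup_n A n).
    exact: nondecreasing_cvg_mu mA (bigcup_measurable (fun n _ => mA n)) nd.
  rewrite -(cvg_lim _ cv)//; apply: lime_le.
    by apply/cvg_ex; exists (P x (\bigcup_n A n)).
  by near=> n; exact: Abd.
(* The average of v at x is 1 - 1 / [greenR x x], by the first-step equation at the pole. *)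
rewrite lte_fin vE -(ltr_pM2l gx) mulrA divff ?gt_eqF// mul1r mulr1.
by rewrite [ltRHS](greenRE finite_nbrs deg_gt0 greenN_bounded) eqxx ltrDr.
Unshelve. all: by end_near. Qed.

Lemma srw_green x y : green e P X x y = (greenR x y / (deg e y)%:R)%:E.
Proof.
rewrite /green mulrC EFinM; congr (_ * _)%E.
rewrite integral_nneseries//; last first.
  by move=> k; apply/measurable_EFinP; exact: measurable_indic.
have visits k :
    (\int[P x]_w (\1_(X k @^-1` [set y]) w)%:E = (trans k x y)%:E)%E.
  by rewrite integral_indic// setIT; exact: srw_marginal.
under eq_eseriesr do rewrite visits.
apply/cvg_lim => //.
apply: (@cvg_trans _ (EFin \o (fun n => greenN n x y) @ \oo)).
  apply: near_eq_cvg; near=> n.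
  by rewrite /= sumEFin big_mkord.
apply: cvg_EFin; first by near=> n.
exact: greenN_cvg.
Unshelve. all: by end_near. Qed.

End RandomWalk.

(** * Gaussian laws *)

Section RealLine.
Variable R : realType.
Local Notation mu := (@lebesgue_measure R).

Lemma is_derive_continuous (F f : R -> R) :
  (forall x : R, is_derive x 1 F (f x)) -> continuous F.
Proof.
move=> dF x; apply/differentiable_continuous/derivable1_diffP.
by have [] := dF x.
Qed.

(** Serves as integration by parts on the whole line without boundary terms. *)
Lemma Rintegral_derivative_line (F f : R -> R) : continuous f ->
  (forall x : R, is_derive x 1 F (f x)) -> mu.-integrable setT (EFin \o f) ->
  F n%:R @[n --> \oo] --> 0 -> F (- n%:R) @[n --> \oo] --> 0 ->
  \int[mu]_x f x = 0.
Proof.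
move=> cf dF intf Fy FNy.
(* The shift to n + 1 keeps the interval nondegenerate for n = 0. *)
pose D n : set R := `[- n.+1%:R, n.+1%:R]%classic.
have mD n : measurable (D n) by exact: measurable_itv.
have FTC n : (\int[mu]_(x in D n) (f x)%:E = (F n.+1%:R - F (- n.+1%:R))%:E)%E.
  rewrite EFinB; apply: continuous_FTC2.
  - by rewrite -subr_gt0 opprK -natrD ltr0n.
  - by apply: continuous_subspaceT => x; exact: cf.
  - have cF := is_derive_continuous dF.
    split; first by move=> x _; have [] := dF x.
    + by apply: cvg_at_right_filter; exact: cF.
    + by apply: cvg_at_left_filter; exact: cF.
  - by move=> x _; rewrite derive1E; have [_ ->] := dF x.
have [mf _] := integrableP _ _ _ intf.
pose g n := (EFin \o f) \_ (D n).
have [] := @dominated_convergence _ _ _ mu setT measurableT g (EFin \o f)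
  (fun x => `|(f x)%:E|)%E.
- move=> n; apply/(measurable_restrictT _ (mD n)).
  exact: measurable_funTS.
- exact: mf.
- apply: aeW => x _; apply: cvg_near_cst.
  have [N _ hN] := nbhs_infty_ger `|x|.
  near=> n; rewrite /g patchE mem_set// /D/= in_itv/= -ler_norml.
  apply: hN; near: n; exists N => // k /= Nk; exact: leqW.
- exact: integrable_abse.
- apply: aeW => x n _; rewrite /g patchE; case: ifP => // _.
  by rewrite abse0.
move=> _ _ cvg_int; rewrite /Rintegral.
suff : (\int[mu]_x g n x)%E @[n --> \oo] --> (0%:E : \bar R).
  by move=> /(cvg_unique _ cvg_int); rewrite /= => ->.
have -> : (fun n => \int[mu]_x g n x)%E =
    EFin \o (fun n => F n.+1%:R - F (- n.+1%:R)).
  by apply/funext => n; rewrite /g -integral_mkcond FTC.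
apply: cvg_EFin; first by near=> n.
rewrite -[0]subr0; apply: cvgB.
  by have := Fy; rewrite -(cvg_shiftS (fun n => F n%:R)).
by have := FNy; rewrite -(cvg_shiftS (fun n => F (- n%:R))).
Unshelve. all: by end_near. Qed.

End RealLine.

(** * Integration by parts against a normal density *)

Section GaussianDensity.
Variables (R : realType) (m s : R).
Hypothesis s_neq0 : s != 0.
Local Notation mu := (@lebesgue_measure R).
Local Notation p := (normal_pdf m s).

Let s2_gt0 : 0 < s ^+ 2. Proof. by rewrite exprn_even_gt0. Qed.

Lemma is_derive_normal_pdf (x : R) : is_derive x 1 p (- (x - m) / s ^+ 2 * p x).
Proof.
rewrite normal_pdfE// /normal_fun.
apply: is_derive_eq.
rewrite /GRing.scale/=.
by field.
Qed.

(* From t <= exp t with t = (x - m)^2 / (4 s^2). *)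
Lemma sqr_normal_pdf_le : exists2 C : R, 0 <= C &
  forall x, (x - m) ^+ 2 * p x <= C * normal_pdf m (Num.sqrt 2 * s) x.
Proof.
set s' := Num.sqrt 2 * s.
have s'2 : s' ^+ 2 = 2 * s ^+ 2 by rewrite exprMn sqr_sqrtr.
have s'0 : s' != 0 by rewrite mulf_neq0// gt_eqF// sqrtr_gt0.
have k0 := normal_peak_gt0 s'0; have k1 := normal_peak_ge0 s.
exists (4 * s ^+ 2 * normal_peak s / normal_peak s').
  by rewrite divr_ge0 ?(ltW k0)// mulr_ge0// mulr_ge0// sqr_ge0.
move=> x; rewrite !normal_pdfE//.
rewrite mulrCA [leRHS](_ : _ =
  normal_peak s * (4 * s ^+ 2 * normal_fun m s' x)); last first.
  by field; rewrite gt_eqF.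
rewrite ler_wpM2l// /normal_fun s'2.
set t := (x - m) ^+ 2 / (4 * s ^+ 2).
have -> : - (x - m) ^+ 2 / (s ^+ 2 *+ 2) = - t - t by rewrite /t; field.
have -> : - (x - m) ^+ 2 / (2 * s ^+ 2 *+ 2) = - t by rewrite /t; field.
have -> : (x - m) ^+ 2 = 4 * s ^+ 2 * t by rewrite /t; field.
rewrite expRD mulrA ler_pM2r ?expR_gt0// -[leRHS]mulr1.
rewrite -[leLHS]mulrA ler_wpM2l//; first by rewrite mulr_ge0// sqr_ge0.
rewrite expRN ler_pdivrMr ?expR_gt0// mul1r.
by apply: le_trans (expR_ge1Dx t); rewrite lerDr.
Qed.

(** The quadratic factor is absorbed into a normal density of doubled variance. *)
Lemma integrable_quadratic_normal_pdf (h : R -> R) (A : R) :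
  measurable_fun setT h -> (forall x, `|h x| <= A * (1 + (x - m) ^+ 2)) ->
  mu.-integrable setT (EFin \o (fun x => h x * p x)).
Proof.
move=> mh hA; have [C C0 pC] := sqr_normal_pdf_le.
have A0 : 0 <= A.
  have := hA m; rewrite subrr expr0n addr0 mulr1; exact: le_trans.
apply: (@le_integrable _ _ _ mu _ measurableT _
    (fun x => A%:E * ((p x)%:E + C%:E * (normal_pdf m (Num.sqrt 2 * s) x)%:E))%E).
- apply/measurable_EFinP/measurable_funM => //; exact: measurable_normal_pdf.
- move=> x _; rewrite -[leRHS]/(`|A * (p x +
    C * normal_pdf m (Num.sqrt 2 * s) x)|%:E) lee_fin.
  have p0 : 0 <= p x := normal_pdf_ge0 m s x.
  rewrite normrM (ger0_norm p0) [leRHS]ger0_norm; last first.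
    by rewrite mulr_ge0// addr_ge0// mulr_ge0// normal_pdf_ge0.
  apply: (le_trans (ler_wpM2r p0 (hA x))).
  by rewrite -mulrA ler_wpM2l// mulrDl mul1r lerD2l.
apply: integrableZl => //; apply: integrableD => //.
  exact: integrable_normal_pdf.
by apply: integrableZl => //; exact: integrable_normal_pdf.
Qed.

Lemma normal_pdf_cvg0 (g : R -> R) (A : R) (u : nat -> R) :
  (forall x, `|g x| <= A * (1 + `|x - m|)) -> (forall n, n%:R <= `|u n|) ->
  g (u n) * p (u n) @[n --> \oo] --> 0.
Proof.
move=> gA hu; have [C C0 pC] := sqr_normal_pdf_le.
have A0 : 0 <= A.
  have := gA m; rewrite subrr normr0 addr0 mulr1; exact: le_trans.
(* With y = |x - m| at least 1, 1 + y <= 2 y; so y times the quantity is at most K, and the quantity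
   itself is at most K / y. *)
set K := 2 * A * C * normal_peak (Num.sqrt 2 * s).
have s'0 : Num.sqrt 2 * s != 0 by rewrite mulf_neq0// gt_eqF// sqrtr_gt0.
have K0 : 0 <= K by rewrite /K !mulr_ge0// normal_peak_ge0.
have p0 x : 0 <= p x := normal_pdf_ge0 m s x.
apply/cvgr0Pnorm_le => eps eps0; near=> n.
pose x := u n; pose y : R := `|x - m|.
rewrite -/x.
have yn : n%:R - `|m| <= y.
  rewrite lerBlDr; apply: le_trans (hu n) _.
  by have := ler_normD (x - m) m; rewrite subrK.
have y1 : 1 <= y.
  apply: le_trans yn; rewrite lerBrDr; near: n; exact: nbhs_infty_ger.
have yK : K / eps <= y.
  apply: le_trans yn; rewrite lerBrDr; near: n; exact: nbhs_infty_ger.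
have y0 : 0 < y := lt_le_trans ltr01 y1.
rewrite normrM (ger0_norm (p0 x)) -(ler_pM2r y0).
apply: (@le_trans _ _ K); last by rewrite -ler_pdivrMl// mulrC.
apply: (@le_trans _ _ (A * (y + y) * p x * y)).
  rewrite ler_pM2r// ler_wpM2r//.
  apply: le_trans (gA x) _; rewrite ler_wpM2l//.
  by rewrite -/y lerD2r.
have -> : A * (y + y) * p x * y = 2 * A * (y ^+ 2 * p x) by ring.
rewrite /K -[leRHS]mulrA ler_wpM2l ?mulr_ge0//.
rewrite /y real_normK ?num_real//; apply: le_trans (pC x) _.
by rewrite ler_wpM2l// normal_pdf_ub.
Unshelve. all: by end_near. Qed.

(** The derivative of g p is g' p - g (x - m) p / s^2, and its integral vanishes. The choices g = 1,
    g = x - m and g = sin yield the mean, the variance and the cosine transform. *)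
Lemma stein_normal_pdf (g g' : R -> R) (A : R) : continuous g' ->
  (forall x : R, is_derive x 1 g (g' x)) ->
  (forall x, `|g x| <= A * (1 + `|x - m|)) -> (forall x, `|g' x| <= A) ->
  \int[mu]_x (g x * (x - m) * p x) = s ^+ 2 * \int[mu]_x (g' x * p x).
Proof.
move=> cg' dg gA g'A.
have cg := is_derive_continuous dg.
have A0 : 0 <= A by exact: le_trans (g'A 0).
have cp : continuous p by exact: continuous_normal_pdf.
have cxm : continuous (fun x : R => x - m).
  by move=> x; apply: cvgB; [exact: cvg_id|exact: cvg_cst].
have mc (f : R -> R) : continuous f -> measurable_fun setT f.
  exact: continuous_measurable_fun.
have i1 : mu.-integrable setT (EFin \o (fun x => g' x * p x)).
  apply: (@integrable_quadratic_normal_pdf _ A); first exact: mc.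
  move=> x; apply: le_trans (g'A x) _.
  by rewrite ler_peMr// lerDl sqr_ge0.
have i2 : mu.-integrable setT (EFin \o (fun x => g x * (x - m) * p x)).
  apply: (@integrable_quadratic_normal_pdf _ (2 * A)).
    by apply: mc => x; apply: cvgM; [exact: cg|exact: cxm].
  move=> x; rewrite normrM.
  apply: (le_trans (ler_wpM2r (normr_ge0 _) (gA x))).
  rewrite (mulrC 2) -!mulrA ler_wpM2l// -[in leRHS]real_normK ?num_real//.
  set y := `|x - m|; have : 0 <= (y - 1) ^+ 2 := sqr_ge0 _.
  by have : 0 <= y ^+ 2 := sqr_ge0 _; nra.
have i3 : mu.-integrable setT
    (EFin \o (fun x => (s ^+ 2)^-1 * (g x * (x - m) * p x))).
  rewrite /comp; under eq_fun do rewrite EFinM.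
  by apply: integrableZl => //; exact: i2.
have : \int[mu]_x (g' x * p x - (s ^+ 2)^-1 * (g x * (x - m) * p x)) = 0.
  apply: (@Rintegral_derivative_line _ (fun x => g x * p x)).
  - move=> x; apply: cvgB; first by apply: cvgM; [exact: cg'|exact: cp].
    apply: cvgM; first exact: cvg_cst.
    apply: cvgM; last exact: cp.
    by apply: cvgM; [exact: cg|exact: cxm].
  - move=> x; have dgx := dg x; have dp := is_derive_normal_pdf x.
    apply: is_derive_eq; rewrite /GRing.scale/=.
    by field.
  - exact: (integrableB measurableT i1 i3).
  - by apply: (@normal_pdf_cvg0 g A (fun n => n%:R) gA) => n; rewrite ger0_norm.
  - apply: (@normal_pdf_cvg0 g A (fun n => - n%:R) gA) => n.
    by rewrite normrN ger0_norm.
rewrite RintegralB//.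
rewrite RintegralZl// => /eqP; rewrite subr_eq0 => /eqP ->.
by rewrite mulrA divff ?mul1r// gt_eqF.
Qed.

End GaussianDensity.

Lemma normr_le_1Dsqr (R : realDomainType) (x : R) : `|x| <= 1 + x ^+ 2.
Proof.
rewrite -(real_normK (num_real x)).
by have := sqr_ge0 (`|x| - 1); have := sqr_ge0 `|x|; nra.
Qed.

Section GaussianLaw.
Variable R : realType.
Local Notation mu := (@lebesgue_measure R).

(** [normal_pdf] agrees almost everywhere with the Radon-Nikodym derivative of [normal_prob], since
    both have the same integrals over measurable sets. *)
Lemma ge0_integral_normal_prob (m s : R) (f : R -> \bar R) :
  measurable_fun setT f -> (forall x, 0 <= f x)%E ->
  (\int[normal_prob m s]_x f x = \int[mu]_x (f x * (normal_pdf m s x)%:E))%E.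
Proof.
move=> mf f0; have dom := normal_prob_dominates m s.
rewrite -(Radon_Nikodym_SigmaFinite.change_of_variables dom f0 measurableT mf).
have fint := Radon_Nikodym_SigmaFinite.f_integrable dom.
have mp : measurable_fun setT (fun x => (normal_pdf m s x)%:E).
  by apply/measurable_EFinP; exact: measurable_normal_pdf.
apply: ae_eq_integral => //.
- by apply: emeasurable_funM => //; exact: measurable_int fint.
- exact: emeasurable_funM.
apply: ae_eqe_mul2l; apply: integral_ae_eq => // E _ mE.
by rewrite -Radon_Nikodym_SigmaFinite.f_integral.
Qed.

Section Transfer.
Variables (d : measure_display) (T : measurableType d) (P : probability T R).
Variables (U : T -> R) (m s : R).
Hypothesis mU : measurable_fun setT U.
Hypothesis U_law : forall B, measurable B -> P (U @^-1` B) = normal_prob m s B.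
Local Notation p := (normal_pdf m s).

Lemma ge0_integral_normal_rv (f : R -> R) :
  measurable_fun setT f -> (forall x, 0 <= f x) ->
  (\int[P]_w (f (U w))%:E = \int[mu]_x (f x * p x)%:E)%E.
Proof.
move=> mf f0; under [RHS]eq_integral do rewrite EFinM.
have mEf : measurable_fun setT (EFin \o f) by exact/measurable_EFinP.
rewrite -(@ge0_integral_normal_prob m s (EFin \o f)) => [|//|x]; last first.
  by rewrite lee_fin.
have mU' : measurable_fun setT (U : T -> measurableTypeR R) by exact: mU.
pose X : {mfun T >-> measurableTypeR R} := MeasurableFun.Pack
  (MeasurableFun.Class (isMeasurableFun.Build _ _ _ _ _ mU')).
transitivity (\int[distribution P X]_x (EFin \o f) x)%E.
  by rewrite ge0_integral_distribution// => x; rewrite lee_fin.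
by apply: eq_measure_integral => A mA _; exact: U_law.
Qed.

Lemma integral_normal_rv (f : R -> R) :
  measurable_fun setT f -> mu.-integrable setT (EFin \o (fun x => f x * p x)) ->
  P.-integrable setT (EFin \o (f \o U)) /\
  \int[P]_w f (U w) = \int[mu]_x (f x * p x).
Proof.
move=> mf intf.
have intP : P.-integrable setT (EFin \o (f \o U)).
  apply/integrableP; split.
    by apply/measurable_EFinP; exact: measurableT_comp.
  rewrite /= (ge0_integral_normal_rv (f := fun x => `|f x|))//; last first.
    exact: measurableT_comp.
  have /integrableP[_] := intf; apply: le_lt_trans.
  apply: ge0_le_integral => //.
  - by move=> x _; rewrite lee_fin mulr_ge0// normal_pdf_ge0.
  - apply/measurable_EFinP/measurable_funM; first exact: measurableT_comp.
    exact: measurable_normal_pdf.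
  - have [+ _] := integrableP _ _ _ intf => mfp.
    exact: measurableT_comp.
  - move=> x _; rewrite /= lee_fin normrM.
    by rewrite [in leRHS](ger0_norm (normal_pdf_ge0 m s x)).
split=> //.
pose fp x : R := Num.max (f x) 0; pose fn x : R := Num.max (- f x) 0.
have mfp : measurable_fun setT fp by exact: measurable_maxr.
have mfn : measurable_fun setT fn.
  by apply: measurable_maxr => //; exact: measurableT_comp.
have fE x : f x = fp x - fn x.
  by rewrite /fp /fn; have [?|?] := lerP (f x) 0; have [?|?] := lerP (- f x) 0; lra.
have fp0 x : 0 <= fp x by rewrite le_max lexx orbT.
have fn0 x : 0 <= fn x by rewrite le_max lexx orbT.
have fpf x : fp x <= `|f x| by rewrite ge_max ler_norm normr_ge0.
have fnf x : fn x <= `|f x| by rewrite ge_max -normrN ler_norm normr_ge0.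
have i1 (g : R -> R) : measurable_fun setT g -> (forall x, 0 <= g x) ->
    (forall x, g x <= `|f x|) ->
    P.-integrable setT (EFin \o (g \o U)) /\
    mu.-integrable setT (EFin \o (fun x => g x * p x)).
  move=> mg g0 gf; split.
    apply: (le_integrable _ _ _ intP) => //.
      by apply/measurable_EFinP; exact: measurableT_comp.
    by move=> w _; rewrite /= lee_fin ger0_norm.
  apply: (le_integrable _ _ _ intf) => //.
    by apply/measurable_EFinP/measurable_funM => //; exact: measurable_normal_pdf.
  move=> x _; rewrite /= lee_fin !normrM ler_wpM2r//.
  by rewrite ger0_norm.
have [ip1 ip2] := i1 _ mfp fp0 fpf.
have [in1 in2] := i1 _ mfn fn0 fnf.
transitivity (\int[P]_w (fp (U w) - fn (U w))).
  by apply: eq_Rintegral => w _; rewrite fE.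
rewrite RintegralB//.
transitivity (\int[mu]_x (fp x * p x - fn x * p x)); last first.
  by apply: eq_Rintegral => w _; rewrite -mulrBl -fE.
rewrite RintegralB//.
by rewrite /Rintegral !ge0_integral_normal_rv.
Qed.

Hypothesis s_neq0 : s != 0.

Lemma normal_rv_mean :
  P.-integrable setT (EFin \o U) /\ \int[P]_w U w = m.
Proof.
have mU' := @integral_normal_rv id (@measurable_id _ _ _).
have int1 := @integrable_quadratic_normal_pdf R m s s_neq0.
have ic : mu.-integrable setT (EFin \o (fun x => (x - m) * p x)).
  apply: (int1 _ 1) => [|x].
    by apply: measurable_funB.
  by rewrite mul1r normr_le_1Dsqr.
have ip := integrable_normal_pdf m s.
have ii : mu.-integrable setT (EFin \o (fun x => x * p x)).
  have := integrableD measurableT ic (integrableZl measurableT m ip).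
  apply: eq_integrable => // x _; rewrite /= -EFinM -EFinD; congr EFin; ring.
have [iU ->] := mU' ii; split=> //.
have := @stein_normal_pdf R m s s_neq0 (fun=> 1) (fun=> 0) 1.
have -> : \int[mu]_x (x * p x) = \int[mu]_x (1 * (x - m) * p x + m * p x).
  by apply: eq_Rintegral => x _; ring.
have c0 : continuous (fun _ : R => 0 : R) by move=> x; exact: cvg_cst.
move=> /(_ c0).
rewrite RintegralD//; last 2 first.
- by under eq_fun do rewrite mul1r.
- by rewrite /comp; under eq_fun do rewrite EFinM; exact: integrableZl.
move=> -> //.
- rewrite !RintegralZl// mul0r mulr0 add0r.
  by rewrite /Rintegral integral_normal_pdf mulr1.
- by move=> x; rewrite normr1 mul1r lerDl.
- by move=> x; rewrite normr0.
Qed.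

Lemma normal_rv_variance :
  P.-integrable setT (EFin \o (fun w => (U w - m) ^+ 2)) /\
  \int[P]_w (U w - m) ^+ 2 = s ^+ 2.
Proof.
have cxm : continuous (fun x : R => x - m).
  by move=> x; apply: cvgB; [exact: cvg_id|exact: cvg_cst].
have := @integral_normal_rv (fun x => (x - m) ^+ 2).
move=> /(_ _)/(_ _)[||iU ->].
- by apply: measurable_funX; exact: continuous_measurable_fun.
- apply: (@integrable_quadratic_normal_pdf R m s s_neq0 _ 1).
    by apply: measurable_funX; exact: continuous_measurable_fun.
  by move=> x; rewrite mul1r ger0_norm ?sqr_ge0// lerDr.
split=> //.
transitivity (\int[mu]_x ((x - m) * (x - m) * p x)).
  by apply: eq_Rintegral => x _; rewrite expr2.
have dg (x : R) : is_derive x 1 (fun x => x - m) (1 : R).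
  by apply: is_derive_eq; rewrite subr0.
have c1 : continuous (fun _ : R => 1 : R) by move=> x; exact: cvg_cst.
rewrite (stein_normal_pdf s_neq0 c1 dg (A := 1)).
- by under eq_Rintegral do rewrite mul1r; rewrite /Rintegral integral_normal_pdf mulr1.
- by move=> x; rewrite mul1r lerDr.
- by move=> x; rewrite normr1.
Qed.

End Transfer.

Section GaussianCos.
Variable s : R.
Hypothesis s_neq0 : s != 0.
Local Notation p := (normal_pdf 0 s).

(** The phase th covers the real and imaginary parts of the characteristic function at once, without
    complex numbers. *)
Definition cos_transform (th t : R) : R := \int[mu]_x (cos (t * x + th) * p x).

Let mcos (t th : R) : measurable_fun setT (fun x : R => cos (t * x + th)).
Proof.
apply: continuous_measurable_fun.
apply: (@is_derive_continuous _ _ (fun x => - (t * sin (t * x + th)))) => x.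
by apply: is_derive_eq; rewrite /GRing.scale/=; ring.
Qed.

Lemma integrable_cos_normal_pdf (th t : R) :
  mu.-integrable setT (EFin \o (fun x => cos (t * x + th) * p x)).
Proof.
apply: (@integrable_quadratic_normal_pdf R 0 s s_neq0 _ 1) => // x.
by rewrite mul1r (le_trans (_ : _ <= 1)) ?lerDl ?sqr_ge0// ler_norml cos_geN1 cos_le1.
Qed.

(** Differentiation under the integral, dominated by |x| p(x), produces x sin (t x + th); Stein's
    identity turns it back into a cosine. *)
Lemma is_derive_cos_transform (th t : R) :
  is_derive t 1 (cos_transform th) (- (s ^+ 2 * t * cos_transform th t)).
Proof.
pose f (t x : R) := cos (t * x + th) * p x.
have df (u x : R) : is_derive u 1 (f ^~ x) (- (sin (u * x + th) * x * p x)).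
  by rewrite /f; apply: is_derive_eq; rewrite /GRing.scale/=; ring.
have df1 (u x : R) : (f ^~ x)^`()%classic u = - (sin (u * x + th) * x * p x).
  by rewrite derive1E; have [_ ->] := df u x.
have tI : `]t - 1, t + 1[%classic t.
  by rewrite /= in_itv/=; apply/andP; split; lra.
have intG : mu.-integrable setT (EFin \o (fun x : R => `|x| * p x)).
  apply: (@integrable_quadratic_normal_pdf R 0 s s_neq0 _ 1).
    exact: normr_measurable.
  by move=> x; rewrite normr_id mul1r subr0 normr_le_1Dsqr.
have G0 x : 0 <= `|x| * p x by rewrite mulr_ge0 ?normal_pdf_ge0.
have dG (u x : R) : `]t - 1, t + 1[%classic u -> setT x ->
    `|partial1of2 f u x| <= `|x| * p x.
  move=> _ _; rewrite /partial1of2 df1 normrN !normrM.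
  rewrite (ger0_norm (normal_pdf_ge0 _ _ _)).
  rewrite ler_wpM2r ?normal_pdf_ge0// ler_piMl//.
  by rewrite ler_norml sin_geN1 sin_le1.
have intf u : `]t - 1, t + 1[%classic u -> mu.-integrable setT (EFin \o f u).
  by move=> _; exact: integrable_cos_normal_pdf.
have der u x : `]t - 1, t + 1[%classic u -> setT x -> derivable (f ^~ x) u 1.
  by move=> _ _; have [] := df u x.
apply: DeriveDef.
  exact: (derivable_under_integral measurableT tI intf der G0 intG dG).
rewrite -derive1E.
rewrite (differentiation_under_integral measurableT tI intf der G0 intG dG).
have -> : \int[mu]_x (partial1of2 f ^~ x) t =
    \int[mu]_x (- 1 * (sin (t * x + th) * (x - 0) * p x)).
  by apply: eq_Rintegral => x _; rewrite /partial1of2 df1; ring.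
have dsin (x : R) :
    is_derive x 1 (fun x => sin (t * x + th)) (t * cos (t * x + th)).
  by apply: is_derive_eq; rewrite /GRing.scale/=; ring.
have cdsin : continuous (fun x => t * cos (t * x + th)).
  apply: (@is_derive_continuous _ _ (fun x => - (t ^+ 2 * sin (t * x + th)))).
  by move=> x; apply: is_derive_eq; rewrite /GRing.scale/=; ring.
rewrite RintegralZl//; last first.
  apply: (@integrable_quadratic_normal_pdf R 0 s s_neq0 _ 1).
    apply: measurable_funM.
      exact: continuous_measurable_fun (is_derive_continuous dsin).
    exact: measurable_funB.
  move=> x; rewrite mul1r normrM; apply: (@le_trans _ _ (1 * `|x - 0|)).
    by rewrite ler_wpM2r// ler_norml sin_geN1 sin_le1.
  by rewrite mul1r normr_le_1Dsqr.
rewrite (stein_normal_pdf s_neq0 cdsin dsin (A := 1 + `|t|)).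
- under eq_Rintegral do rewrite -mulrA.
  rewrite RintegralZl//; last exact: integrable_cos_normal_pdf.
  by rewrite /cos_transform; ring.
- move=> x; apply: (@le_trans _ _ 1).
    by rewrite ler_norml sin_geN1 sin_le1.
  have := normr_ge0 t; have := normr_ge0 (x - 0); nra.
- move=> x; rewrite normrM; have := normr_ge0 t.
  have : `|cos (t * x + th)| <= 1 by rewrite ler_norml cos_geN1 cos_le1.
  by have := normr_ge0 (cos (t * x + th)); nra.
Qed.

(** The transform solves F' = - s^2 t F, so its product with the integrating factor is constant. *)
Lemma cos_transformE (th t : R) :
  cos_transform th t = cos th * expR (- (s ^+ 2 * t ^+ 2 / 2)).
Proof.
pose h u := cos_transform th u * expR (s ^+ 2 * u ^+ 2 / 2).
have dh (u : R) : is_derive u 1 h 0.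
  have := is_derive_cos_transform th u => ?.
  by apply: is_derive_eq; rewrite /GRing.scale/=; field.
have h0 : h t = h 0 by exact: is_derive_0_is_cst.
have : h 0 = cos th.
  rewrite /h expr0n/= mulr0 mul0r expR0 mulr1 /cos_transform.
  under eq_Rintegral do rewrite mul0r add0r.
  rewrite RintegralZl//; last exact: integrable_normal_pdf.
  by rewrite /Rintegral integral_normal_pdf mulr1.
rewrite -h0 => <-; rewrite /h -mulrA -expRD subrr expR0 mulr1.
by [].
Qed.

End GaussianCos.
End GaussianLaw.

Section GaussianVariable.
Variables (R : realType) (d : measure_display) (T : measurableType d).
Variable P : probability T R.

Lemma integral_cst_probability (c : R) : (\int[P]__ c%:E = c%:E)%E.
Proof.
rewrite integral_cst// [X in (_ * X)%E](_ : _ = 1%E) ?mule1//.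
exact: probability_setT.
Qed.

Lemma dirac_rv (U : T -> R) (m : R) (f : R -> R) :
  measurable_fun setT U ->
  (forall B : set R, measurable B -> P (U @^-1` B) = \d_m B) ->
  measurable_fun setT f ->
  P.-integrable setT (EFin \o (f \o U)) /\ \int[P]_w f (U w) = f m.
Proof.
move=> mU lawU mf.
have mfU : measurable_fun setT (f \o U) by exact: measurableT_comp.
have Um : P (U @^-1` [set m]) = 1%E.
  by rewrite lawU// diracE mem_set.
have mA : measurable (U @^-1` [set m]).
  by rewrite -[X in measurable X]setTI; exact: mU.
have UmC : P (~` (U @^-1` [set m])) = 0%E.
  by rewrite probability_setC// Um subee.
have ae_cst (g : R -> R) :
    ae_eq P setT (fun w => (g (U w))%:E) (fun=> (g m)%:E).
  exists (~` (U @^-1` [set m])); split.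
  - exact: measurableC.
  - exact: UmC.
  - by move=> w /= h Uw; apply: h => _; rewrite Uw.
have icst : P.-integrable setT (EFin \o (fun=> f m)).
  exact: finite_measure_integrable_cst.
split.
  apply/integrableP; split; first exact/measurable_EFinP.
  rewrite (ae_eq_integral (fun=> (`|f m|)%:E))//=.
  - by rewrite integral_cst_probability ltry.
  - by apply/measurable_EFinP; exact: measurableT_comp.
  - exact: (ae_cst (fun x => `|f x|)).
rewrite /Rintegral (ae_eq_integral (fun=> (f m)%:E))//=.
  by rewrite integral_cst_probability.
exact/measurable_EFinP.
Qed.

Lemma gaussian_rv_mean_variance (U : T -> R) :
  measurable_fun setT U -> gaussian_rv P U ->
  exists m s : R, [/\ forall B, measurable B -> P (U @^-1` B) = gaussian_law m s B,
    P.-integrable setT (EFin \o U) /\ \int[P]_w U w = m &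
    P.-integrable setT (EFin \o (fun w => (U w - m) ^+ 2)) /\
    \int[P]_w (U w - m) ^+ 2 = s ^+ 2].
Proof.
move=> mU [m [s lawU]]; exists m, s; split => //.
  move: lawU; rewrite /gaussian_law; have [_|s0] := eqVneq s 0 => lawU.
    exact: (dirac_rv mU lawU (@measurable_id _ _ _)).
  exact: normal_rv_mean mU lawU s0.
move: lawU; rewrite /gaussian_law; have [->|s0] := eqVneq s 0 => lawU.
  have := @dirac_rv U m (fun x => (x - m) ^+ 2) mU lawU.
  rewrite subrr expr0n/=; apply.
  by apply: measurable_funX; exact: measurable_funB.
exact: normal_rv_variance mU lawU s0.
Qed.

Lemma gaussian_rv_L2 (U : T -> R) :
  measurable_fun setT U -> gaussian_rv P U ->
  P.-integrable setT (EFin \o U) /\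
  P.-integrable setT (EFin \o (fun w => U w ^+ 2)).
Proof.
move=> mU gU; have [m [s [_ [iU _] [iU2 _]]]] := gaussian_rv_mean_variance mU gU.
split => //.
have ic : P.-integrable setT (EFin \o (fun=> m ^+ 2)).
  exact: finite_measure_integrable_cst.
have := integrableB measurableT
  (integrableD measurableT iU2 (integrableZl measurableT (2 * m) iU)) ic.
apply: eq_integrable => // w _.
rewrite [LHS](_ : _ = ((U w - m) ^+ 2 + 2 * m * U w - m ^+ 2)%:E)//.
by congr EFin; ring.
Qed.

(** The parameters in [gaussian_rv] are only known to exist; the first two moments identify them.
    The law is given for s nonzero because of the convention on [normal_prob] at 0. *)
Lemma centered_gaussian_rv (U : T -> R) :
  measurable_fun setT U -> gaussian_rv P U -> \int[P]_w U w = 0 ->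
  exists s : R, [/\ s ^+ 2 = \int[P]_w U w ^+ 2,
    forall t th, \int[P]_w cos (t * U w + th) =
      cos th * expR (- (s ^+ 2 * t ^+ 2 / 2)) &
    s != 0 -> forall B, measurable B -> P (U @^-1` B) = normal_prob 0 s B].
Proof.
move=> mU gU EU.
have [m [s [lawU [_ Um] [_ Us]]]] := gaussian_rv_mean_variance mU gU.
move: Um; rewrite EU => m0; subst m; exists s; split.
- by rewrite -Us; apply: eq_Rintegral => w _; rewrite subr0.
- move=> t th; have mcos : measurable_fun setT (fun x : R => cos (t * x + th)).
    apply: continuous_measurable_fun.
    apply: (@is_derive_continuous _ _ (fun x => - (t * sin (t * x + th)))) => x.
    by apply: is_derive_eq; rewrite /GRing.scale/=; ring.
  move: lawU; rewrite /gaussian_law; have [->|s0] := eqVneq s 0 => lawU.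
    have [_ ->] := dirac_rv mU lawU mcos.
    by rewrite mulr0 add0r expr0n/= !mul0r oppr0 expR0 mulr1.
  rewrite -(cos_transformE s0 th t).
  by have [_ ->] := integral_normal_rv mU lawU mcos (integrable_cos_normal_pdf s0 th t).
- by move=> s0 B mB; rewrite lawU// /gaussian_law (negbTE s0).
Qed.

End GaussianVariable.

(** * Independence from cosine transforms *)

Section StepPolynomial.
Variable R : realType.

(* Brosowski and Deutsch's polynomials for the Stone-Weierstrass theorem. *)
Definition step_poly n : {poly R} :=
  (1 - (2^-1 *: ('X + 1)) ^+ n) ^+ (n * 2 ^ n).

Lemma step_polyE n (c : R) :
  (step_poly n).[c] = (1 - ((c + 1) / 2) ^+ n) ^+ (n * 2 ^ n).
Proof. by rewrite /step_poly !hornerE mulrC. Qed.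

Lemma step_poly_itv n (c : R) : -1 <= c <= 1 -> 0 <= (step_poly n).[c] <= 1.
Proof.
move=> /andP[c1 c2]; have u0 : 0 <= (c + 1) / 2 by lra.
have u1 : (c + 1) / 2 <= 1 by lra.
have h : 0 <= 1 - ((c + 1) / 2) ^+ n <= 1.
  by rewrite subr_ge0 exprn_ile1//= gerBl exprn_ge0.
case/andP: h => h0 h1.
by rewrite step_polyE exprn_ge0//= exprn_ile1.
Qed.

Lemma bernoulli_ge (x : R) k : 0 <= x <= 1 -> 1 - k%:R * x <= (1 - x) ^+ k.
Proof.
move=> /andP[x0 x1]; elim: k => [|k IH]; first by rewrite mul0r subr0.
rewrite exprS; apply: (@le_trans _ _ ((1 - x) * (1 - k%:R * x))).
  have : 0 <= k%:R * x * x by rewrite !mulr_ge0.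
  by rewrite -natr1; nra.
by rewrite ler_wpM2l// subr_ge0.
Qed.

(** Because (1 - x)^k (1 + x)^k <= 1, while (1 + x)^k is at least 1 + k x. *)
Lemma pow_sub_le_inv (x : R) k : 0 <= x <= 1 ->
  (1 - x) ^+ k <= (1 + k%:R * x)^-1.
Proof.
move=> /andP[x0 x1]; have k0 : 0 <= k%:R * x by rewrite mulr_ge0.
rewrite -[leRHS]mul1r ler_pdivlMr; last by lra.
have h : 1 + k%:R * x <= (1 + x) ^+ k.
  elim: k {k0} => [|k IH]; first by rewrite mul0r addr0.
  rewrite exprS; apply: (@le_trans _ _ ((1 + x) * (1 + k%:R * x))).
    have : 0 <= k%:R * x * x by rewrite !mulr_ge0.
    by rewrite -natr1; nra.
  by rewrite ler_wpM2l//; lra.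
apply: (@le_trans _ _ ((1 - x) ^+ k * (1 + x) ^+ k)).
  by rewrite ler_wpM2l// exprn_ge0// subr_ge0.
rewrite -exprMn exprn_ile1//; nra.
Qed.

(** With r the square root of q, one factor r^n absorbs n by [pow_sub_le_inv] and the other tends to
    0. *)
Lemma cvg_nat_mul_expr (q : R) : 0 <= q < 1 ->
  n%:R * q ^+ n @[n --> \oo] --> 0.
Proof.
move=> /andP[q0 q1]; pose r : R := Num.sqrt q.
have r0 : 0 <= r by rewrite sqrtr_ge0.
have rq : r ^+ 2 = q by rewrite sqr_sqrtr.
have r1 : r < 1 by rewrite -(ltr_pXn2r (n := 2)) ?nnegrE// rq expr1n.
have x0 : 0 < 1 - r by rewrite subr_gt0.
have bnd n : n%:R * q ^+ n <= (1 - r)^-1 * r ^+ n.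
  rewrite -rq -exprM mulnC exprM -[X in _ * X]/(r ^+ n * r ^+ n) mulrA.
  rewrite ler_wpM2r ?exprn_ge0//.
  have hn : 0 < 1 + n%:R * (1 - r).
    by rewrite ltr_pwDl// mulr_ge0// ltW.
  have := @pow_sub_le_inv (1 - r) n; rewrite subKr => h.
  have : r ^+ n <= (1 + n%:R * (1 - r))^-1.
    by apply: h; rewrite (ltW x0)/= gerBl.
  rewrite -[(_ + _)^-1]mul1r -[(1 - r)^-1]mul1r !ler_pdivlMr// => h1.
  by have := exprn_ge0 n r0; nra.
apply: (@squeeze_cvgr _ _ _ _ (cst 0) (fun n => (1 - r)^-1 * r ^+ n)).
- by near=> n; rewrite bnd andbT mulr_ge0// exprn_ge0.
- exact: cvg_cst.
- rewrite -[X in _ --> X](mulr0 (1 - r)^-1); apply: cvgM; first exact: cvg_cst.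
  by apply: cvg_expr; rewrite ger0_norm.
Unshelve. all: by end_near. Qed.

(** With u = (c + 1) / 2, the exponent times u^n equals n (2 u)^n, which tends to 0 if c < 0 and is
    at least n if c >= 0. The two Bernoulli bounds then give the limits 1 and 0. *)
Lemma cvg_step_poly (c : R) : -1 <= c <= 1 ->
  (step_poly n).[c] @[n --> \oo] --> ((c < 0)%R%:R : R).
Proof.
move=> c1; set u := (c + 1) / 2.
have u01 : 0 <= u <= 1 by rewrite /u; case/andP: c1 => *; apply/andP; split; lra.
have un01 n : 0 <= u ^+ n <= 1.
  by case/andP: u01 => *; rewrite exprn_ge0//= exprn_ile1.
have knu n : (n * 2 ^ n)%:R * u ^+ n = n%:R * (2 * u) ^+ n.
  by rewrite natrM natrX -mulrA -exprMn.
have [cl|cg] := ltP c 0.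
  have q0 : 0 <= 2 * u by rewrite mulr_ge0//; case/andP: u01.
  have q1 : 2 * u < 1 by rewrite /u; lra.
  apply: (@squeeze_cvgr _ _ _ _ (fun n => 1 - n%:R * (2 * u) ^+ n) (cst 1)).
  - near=> n; case/andP: (step_poly_itv n c1) => _ ->.
    by rewrite andbT step_polyE -/u -knu bernoulli_ge.
  - rewrite -[X in _ --> X]subr0; apply: cvgB; first exact: cvg_cst.
    by apply: cvg_nat_mul_expr; rewrite q0.
  - exact: cvg_cst.
apply: (@squeeze_cvgr _ _ _ _ (cst 0) (fun n => n.+1%:R^-1)).
- near=> n; case/andP: (step_poly_itv n c1) => -> _ /=.
  rewrite step_polyE -/u; apply: le_trans (pow_sub_le_inv _ (un01 n)) _.
  rewrite lef_pV2 ?posrE// ?knu; last first.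
    by rewrite ltr_pwDl// mulr_ge0// exprn_ge0//; rewrite /u; lra.
  rewrite -natr1 addrC lerD2l ler_peMr// exprn_ege1//; rewrite /u; lra.
- exact: cvg_cst.
- exact: cvg_harmonic.
Unshelve. all: by end_near. Qed.

End StepPolynomial.

(** * Bounded random variables orthogonal to all cosines of another one *)

Section BoundedVariables.
Variables (R : realType) (d : measure_display) (T : measurableType d).
Variable P : probability T R.

Definition bounded_rv (f : T -> R) : Prop :=
  measurable_fun setT f /\ exists M, forall w, `|f w| <= M.

Lemma bounded_rv_integrable f : bounded_rv f -> P.-integrable setT (EFin \o f).
Proof.
move=> [mf [M hM]]; have iM : P.-integrable setT (EFin \o (fun=> M)).
  exact: finite_measure_integrable_cst.
apply: (le_integrable measurableT _ _ iM); first exact/measurable_EFinP.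
by move=> w _ /=; rewrite lee_fin (le_trans (hM w))// ler_norm.
Qed.

Lemma bounded_rv_cst c : bounded_rv (fun=> c).
Proof. by split; [exact: measurable_cst|exists `|c|]. Qed.

Lemma bounded_rvM f g : bounded_rv f -> bounded_rv g ->
  bounded_rv (fun w => f w * g w).
Proof.
move=> [mf [M hM]] [mg [N hN]]; split; first exact: measurable_funM.
by exists (M * N) => w; rewrite normrM ler_pM.
Qed.

Lemma bounded_rvD f g : bounded_rv f -> bounded_rv g ->
  bounded_rv (fun w => f w + g w).
Proof.
move=> [mf [M hM]] [mg [N hN]]; split; first exact: measurable_funD.
by exists (M + N) => w; rewrite (le_trans (ler_normD _ _))// lerD.
Qed.

Lemma bounded_rvB f g : bounded_rv f -> bounded_rv g ->
  bounded_rv (fun w => f w - g w).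
Proof.
move=> bf bg; have := bounded_rvD bf (bounded_rvM (bounded_rv_cst (-1)) bg).
by under eq_fun do rewrite mulN1r.
Qed.

Lemma bounded_rv_comp (k : R -> R) (M : R) (Y : T -> R) :
  measurable_fun setT Y -> measurable_fun setT k -> (forall x, `|k x| <= M) ->
  bounded_rv (fun w => k (Y w)).
Proof. by move=> mY mk kM; split; [exact: measurableT_comp|exists M]. Qed.

Lemma bounded_rv_cos (Y : T -> R) (t th : R) : measurable_fun setT Y ->
  bounded_rv (fun w => cos (t * Y w + th)).
Proof.
move=> mY; apply: (@bounded_rv_comp cos 1 (fun w => t * Y w + th)).
- apply: measurable_funD; last exact: measurable_cst.
  by apply: measurable_funM; first exact: measurable_cst.
- exact: continuous_measurable_fun (@continuous_cos R).
- by move=> x; rewrite ler_norml cos_geN1 cos_le1.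
Qed.

Lemma bounded_rv_horner (f : T -> R) (p : {poly R}) : bounded_rv f ->
  bounded_rv (fun w => p.[f w]).
Proof.
move=> bf; elim/poly_ind: p => [|p c IH].
  by under eq_fun do rewrite horner0; exact: bounded_rv_cst.
under eq_fun do rewrite hornerMXaddC.
exact: bounded_rvD (bounded_rvM IH bf) (bounded_rv_cst c).
Qed.

Lemma Rintegral_cst_probability (c : R) : \int[P]__ c = c.
Proof.
rewrite Rintegral_cst// [X in _ * fine X](_ : _ = 1%E) ?mulr1//.
exact: probability_setT.
Qed.

Lemma RintegralZ_bounded c f : bounded_rv f ->
  \int[P]_w (c * f w) = c * \int[P]_w f w.
Proof. by move=> bf; rewrite RintegralZl//; exact: bounded_rv_integrable. Qed.

Lemma RintegralD_bounded f g : bounded_rv f -> bounded_rv g ->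
  \int[P]_w (f w + g w) = \int[P]_w f w + \int[P]_w g w.
Proof. by move=> bf bg; rewrite RintegralD//; exact: bounded_rv_integrable. Qed.

Lemma RintegralB_bounded f g : bounded_rv f -> bounded_rv g ->
  \int[P]_w (f w - g w) = \int[P]_w f w - \int[P]_w g w.
Proof. by move=> bf bg; rewrite RintegralB//; exact: bounded_rv_integrable. Qed.

Lemma bounded_convergence_0 (f_ : nat -> T -> R) (f : T -> R) (M : R) :
  (forall n, measurable_fun setT (f_ n)) -> measurable_fun setT f ->
  (forall n w, `|f_ n w| <= M) -> (forall w, f_ n w @[n --> \oo] --> f w) ->
  (forall n, \int[P]_w f_ n w = 0) -> \int[P]_w f w = 0.
Proof.
move=> mf_ mf fM ff int0.
have iM : P.-integrable setT (EFin \o (fun=> M)).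
  exact: finite_measure_integrable_cst.
have [] := @dominated_convergence _ _ _ P setT measurableT
  (fun n => EFin \o f_ n) (EFin \o f) (EFin \o (fun=> M)).
- by move=> n; exact/measurable_EFinP.
- exact/measurable_EFinP.
- by apply: aeW => w _; apply: cvg_EFin; [exact: nearW|exact: ff].
- exact: iM.
- by apply: aeW => w n _ /=; rewrite lee_fin.
move=> _ _ cvg_int; rewrite /Rintegral.
have e0 n : (\int[P]_w (EFin \o f_ n) w = 0)%E.
  have b : bounded_rv (f_ n) by split => //; exists M.
  have := int0 n; rewrite /Rintegral => h.
  by rewrite -[LHS]fineK ?h// integrable_fin_num//; exact: bounded_rv_integrable.
move: cvg_int; under eq_fun do rewrite e0.
by move=> /(cvg_unique _ (cvg_cst _)) /= <-.
Qed.

Lemma measurable_halfline (a : R) :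
  measurable_fun setT (fun x : R => (a < x)%R%:R : R).
Proof.
rewrite (_ : (fun x => _) = \1_(`]a, +oo[%classic)).
  exact: measurable_indic.
by apply/funext => x; rewrite indicE mem_setE in_itv/= andbT.
Qed.

(** A form of E[G | Y] = 0, tested on trigonometric functions of Y only; the phase th includes the
    sines. *)
Definition orthogonal_to_cos (G Y : T -> R) : Prop :=
  forall t th, \int[P]_w (G w * cos (t * Y w + th)) = 0.

Lemma cos_mul_cos (x y : R) : cos x * cos y = 2^-1 * (cos (x + y) + cos (x - y)).
Proof. by rewrite !cosD cosN sinN; field. Qed.

(** The extra cosine with free t and th makes the induction on p work: multiplying it by another
    cosine gives two cosines of the same form. *)
Lemma orthogonal_to_cos_poly G Y (p : {poly R}) (om th0 t th : R) :
  bounded_rv G -> measurable_fun setT Y -> orthogonal_to_cos G Y ->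
  \int[P]_w (G w * cos (t * Y w + th) * p.[cos (om * Y w + th0)]) = 0.
Proof.
move=> bG mY GY; elim/poly_ind: p t th => [|p c IH] t th.
  under eq_Rintegral do rewrite horner0 mulr0.
  exact: Rintegral_cst_probability.
have bp : bounded_rv (fun w => p.[cos (om * Y w + th0)]).
  by apply: bounded_rv_horner; exact: bounded_rv_cos.
have bGc u v : bounded_rv (fun w => G w * cos (u * Y w + v)).
  by apply: bounded_rvM => //; exact: bounded_rv_cos.
transitivity (\int[P]_w (2^-1 *
     (G w * cos ((t + om) * Y w + (th + th0)) * p.[cos (om * Y w + th0)] +
      G w * cos ((t - om) * Y w + (th - th0)) * p.[cos (om * Y w + th0)]) +
   c * (G w * cos (t * Y w + th)))).
  apply: eq_Rintegral => w _; rewrite hornerMXaddC.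
  have -> : (t + om) * Y w + (th + th0) =
    (t * Y w + th) + (om * Y w + th0) by ring.
  have -> : (t - om) * Y w + (th - th0) =
    (t * Y w + th) - (om * Y w + th0) by ring.
  rewrite -mulrDl -mulrDr.
  rewrite [RHS](_ : _ = G w * (2^-1 * (cos (t * Y w + th + (om * Y w + th0)) +
    cos (t * Y w + th - (om * Y w + th0)))) * p.[cos (om * Y w + th0)] +
    c * (G w * cos (t * Y w + th))); last by ring.
  by rewrite -cos_mul_cos; ring.
have b1 := bounded_rvM (bGc (t + om) (th + th0)) bp.
have b2 := bounded_rvM (bGc (t - om) (th - th0)) bp.
rewrite RintegralD_bounded; last 2 first.
- exact: bounded_rvM (bounded_rv_cst _) (bounded_rvD b1 b2).
- exact: bounded_rvM (bounded_rv_cst _) (bGc _ _).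
rewrite !RintegralZ_bounded//; last exact: bounded_rvD b1 b2.
by rewrite RintegralD_bounded// !IH GY; ring.
Qed.

Lemma orthogonal_to_cos_arc G Y (om th0 : R) :
  bounded_rv G -> measurable_fun setT Y -> orthogonal_to_cos G Y ->
  \int[P]_w (G w * (cos (om * Y w + th0) < 0)%R%:R) = 0.
Proof.
move=> bG mY GY; have [mG [M hM]] := bG.
have bc := bounded_rv_cos om th0 mY.
have c1 w : -1 <= cos (om * Y w + th0) <= 1 by rewrite cos_geN1 cos_le1.
apply: (@bounded_convergence_0
  (fun n w => G w * (step_poly R n).[cos (om * Y w + th0)]) _ M).
- by move=> n; have [] := bounded_rvM bG (bounded_rv_horner (step_poly R n) bc).
- apply: measurable_funM => //.
  rewrite (_ : (fun w => _) = (fun x : R => (0 < x)%R%:R) \o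
    (fun w => - cos (om * Y w + th0))).
    apply: measurableT_comp; first exact: measurable_halfline.
    by apply: measurableT_comp => //; have [] := bc.
  by apply/funext => w /=; rewrite oppr_gt0.
- move=> n w; rewrite normrM.
  have /andP[p0 p1] := step_poly_itv n (c1 w).
  by rewrite (ger0_norm p0) -[leRHS]mulr1 ler_pM.
- by move=> w; apply: cvgM; [exact: cvg_cst|exact: cvg_step_poly].
- move=> n; have := orthogonal_to_cos_poly (step_poly R n) om th0 0 0 bG mY GY.
  by under eq_Rintegral do rewrite mul0r addr0 cos0 mulr1.
Qed.

(* The arcs (a, a + L) mod 2 L are half circles, and converge pointwise to
   the half-line (a, +oo) as L tends to infinity. *)
Lemma orthogonal_to_cos_halfline G Y (a : R) :
  bounded_rv G -> measurable_fun setT Y -> orthogonal_to_cos G Y ->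
  \int[P]_w (G w * (a < Y w)%R%:R) = 0.
Proof.
move=> bG mY GY; have [mG [M hM]] := bG.
(* With half-period L = n + 1, the phase makes the cosine equal to - sin (om (Y - a)); when |Y - a|
   < L, it is negative exactly if a < Y. *)
pose om n : R := pi / n.+1%:R; pose th n : R := pi / 2 - om n * a.
have mlt : measurable_fun setT (fun w => (a < Y w)%R%:R : R).
  exact: measurableT_comp (measurable_halfline a) mY.
apply: (@bounded_convergence_0
  (fun n w => G w * (cos (om n * Y w + th n) < 0)%R%:R) _ M).
- move=> n; apply: measurable_funM => //.
  rewrite (_ : (fun w => _) = (fun x : R => (0 < x)%R%:R) \o
    (fun w => - cos (om n * Y w + th n))).
    apply: measurableT_comp; first exact: measurable_halfline.
    by apply: measurableT_comp => //; have [] := bounded_rv_cos (om n) (th n) mY.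
  by apply/funext => w /=; rewrite oppr_gt0.
- exact: measurable_funM.
- move=> n w; rewrite normrM -[leRHS]mulr1 ler_pM//.
  by case: (_ < _); rewrite ?normr1 ?normr0.
- move=> w; apply: cvgM; first exact: cvg_cst.
  apply: cvg_near_cst; near=> n.
  have -> : om n * Y w + th n = om n * (Y w - a) + pi / 2.
    by rewrite /th; ring.
  rewrite cosDpihalf oppr_lt0; congr (_%:R); congr nat_of_bool.
  have nY : `|Y w - a| < n.+1%:R.
    rewrite -natr1 ltr_wpDr// ; near: n; exact: nbhs_infty_gtr.
  have n0 : 0 < n.+1%:R :> R by rewrite ltr0n.
  have om0 : 0 < om n by rewrite divr_gt0// pi_gt0.
  have omY x : x < n.+1%:R -> om n * x < pi.
    by move=> xn; rewrite /om mulrAC ltr_pdivrMr// ltr_pM2l// pi_gt0.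
  move: nY; rewrite ltr_norml => /andP[nY1 nY2].
  have [aY|Ya] := ltP a (Y w).
    by rewrite sin_gt0_pi// mulr_gt0 ?subr_gt0//= omY.
  apply/negbTE; rewrite -leNgt -[om n * _]opprK sinN oppr_le0 -mulrN.
  by rewrite sin_ge0_pi// mulr_ge0 ?(ltW om0)//= ?oppr_ge0 ?subr_le0// ltW// omY// ltrNl.
- by move=> n; exact: orthogonal_to_cos_arc.
Unshelve. all: by end_near. Qed.

(** The bounded test functions to which orthogonality extends. Constants, half-lines and differences
    are enough for the noise classes used later. *)
Definition cos_determined (k : R -> R) : Prop :=
  (measurable_fun setT k /\ exists M, forall x, `|k x| <= M) /\
  forall G Y, bounded_rv G -> measurable_fun setT Y -> orthogonal_to_cos G Y ->
    \int[P]_w (G w * k (Y w)) = 0.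

Lemma cos_determined_cst c : cos_determined (fun=> c).
Proof.
split; first by split; [exact: measurable_cst|exists `|c|].
move=> G Y bG mY GY; have := GY 0 0.
under eq_Rintegral do rewrite mul0r addr0 cos0 mulr1.
move=> G0; under eq_Rintegral do rewrite mulrC.
by rewrite RintegralZ_bounded// G0 mulr0.
Qed.

Lemma cos_determined_halfline a : cos_determined (fun x => (a < x)%R%:R).
Proof.
split; last by move=> G Y; exact: orthogonal_to_cos_halfline.
split; first exact: measurable_halfline.
by exists 1 => x; case: (_ < _); rewrite ?normr1 ?normr0.
Qed.

Lemma cos_determinedB k l : cos_determined k -> cos_determined l ->
  cos_determined (fun x => k x - l x).
Proof.
move=> [[mk [A kA]] hk] [[ml [B lB]] hl]; split.
  split; first exact: measurable_funB.
  by exists (A + B) => x; rewrite (le_trans (ler_normB _ _))// lerD.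
move=> G Y bG mY GY; under eq_Rintegral do rewrite mulrBr.
rewrite RintegralB_bounded ?hk ?hl ?subr0//.
  by apply: bounded_rvM => //; exact: (bounded_rv_comp (M := A)).
by apply: bounded_rvM => //; exact: (bounded_rv_comp (M := B)).
Qed.

Section Independence.
Variables (I : eqType) (Z : I -> T -> R) (v : I -> R).
Hypothesis mZ : forall i, measurable_fun setT (Z i).
Hypothesis cosZ : forall (js : seq I) (t : I -> R) (th : R), uniq js ->
  \int[P]_w cos (\sum_(j <- js) t j * Z j w + th) =
  cos th * expR (- (\sum_(j <- js) t j ^+ 2 * v j) / 2).

(** The cosine factors are replaced by general test functions one index at a time. The remaining
    indices stay inside a cosine, since the induction hypothesis is needed for every linear
    combination of them. *)
Lemma integral_prod_cos (k : I -> R -> R) (js ks : seq I) (t : I -> R) (th : R) :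
  (forall j, cos_determined (k j)) -> uniq (js ++ ks) ->
  \int[P]_w ((\prod_(j <- js) k j (Z j w)) *
             cos (\sum_(j <- ks) t j * Z j w + th)) =
  (\prod_(j <- js) \int[P]_w k j (Z j w)) *
  (cos th * expR (- (\sum_(j <- ks) t j ^+ 2 * v j) / 2)).
Proof.
move=> hk.
have bk j : bounded_rv (fun w => k j (Z j w)).
  by have [[mk [M kM]] _] := hk j; exact: bounded_rv_comp kM.
have bprod ls : bounded_rv (fun w => \prod_(j <- ls) k j (Z j w)).
  elim: ls => [|j ls IH].
    by under eq_fun do rewrite big_nil; exact: bounded_rv_cst.
  by under eq_fun do rewrite big_cons; exact: bounded_rvM.
have msum ls u : measurable_fun setT (fun w => \sum_(j <- ls) u j * Z j w).
  elim: ls => [|j ls IH].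
    by under eq_fun do rewrite big_nil; exact: measurable_cst.
  under eq_fun do rewrite big_cons; apply: measurable_funD => //.
  by apply: measurable_funM => //; exact: measurable_cst.
have bcos ls u a : bounded_rv (fun w => cos (\sum_(j <- ls) u j * Z j w + a)).
  have := bounded_rv_cos 1 a (msum ls u).
  by under eq_fun do rewrite mul1r.
elim: js ks t th => [|i js IH] ks t th /=.
  move=> uks; rewrite big_nil mul1r -cosZ//.
  by apply: eq_Rintegral => w _; rewrite big_nil mul1r.
rewrite mem_cat negb_or => /andP[/andP[ijs iks] ujk].
pose L w := \sum_(j <- ks) t j * Z j w.
pose q w := \prod_(j <- js) k j (Z j w).
set Q := \prod_(j <- js) \int[P]_w k j (Z j w) in IH *.
pose S := \sum_(j <- ks) t j ^+ 2 * v j.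
(* C is the expectation of G. Joint expectations of G with cosines of [Z i] factorize, so G - C is
   orthogonal to them. *)
pose C := Q * (cos th * expR (- S / 2)).
pose G w := q w * cos (L w + th).
have bG : bounded_rv G := bounded_rvM (bprod js) (bcos ks t th).
have bGC : bounded_rv (fun w => G w - C).
  exact: bounded_rvB bG (bounded_rv_cst C).
have ujk' : uniq (js ++ i :: ks).
  by rewrite -(cat1s i ks) uniq_catCA /= mem_cat negb_or ijs iks.
have orth : orthogonal_to_cos (fun w => G w - C) (Z i).
  move=> u a.
  have IHu b c : \int[P]_w (q w * cos (b * Z i w + L w + c)) =
      Q * (cos c * expR (- (b ^+ 2 * v i + S) / 2)).
    pose t' j := if j == i then b else t j.
    have t'i : t' i = b by rewrite /t' eqxx.
    have t'k j : j \in ks -> t' j = t j.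
      by rewrite /t'; case: eqP => // -> ik; rewrite ik in iks.
    have -> : b ^+ 2 * v i + S = \sum_(j <- i :: ks) t' j ^+ 2 * v j.
      rewrite big_cons t'i; congr (_ + _).
      by apply: eq_big_seq => j /t'k ->.
    rewrite -IH//; apply: eq_Rintegral => w _; congr (_ * cos (_ + _)).
    rewrite big_cons t'i; congr (_ + _).
    by apply: eq_big_seq => j /t'k ->.
  have cosZi : \int[P]_w cos (u * Z i w + a) = cos a * expR (- (u ^+ 2 * v i) / 2).
    have := @cosZ [:: i] (fun=> u) a isT; rewrite big_seq1 => <-.
    by apply: eq_Rintegral => w _; rewrite big_seq1.
  transitivity (\int[P]_w (2^-1 * (q w * cos (u * Z i w + L w + (th + a)) +
      q w * cos ((- u) * Z i w + L w + (th - a))) -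
      C * cos (u * Z i w + a))).
    apply: eq_Rintegral => w _; rewrite mulrBl; congr (_ - _).
    have -> : u * Z i w + L w + (th + a) = (L w + th) + (u * Z i w + a) by ring.
    have -> : - u * Z i w + L w + (th - a) = (L w + th) - (u * Z i w + a) by ring.
    by rewrite -mulrDr mulrCA -cos_mul_cos mulrA.
  have b1 b c : bounded_rv (fun w => q w * cos (b * Z i w + L w + c)).
    apply: (bounded_rvM (bprod js)).
    have := bcos (i :: ks) (fun j => if j == i then b else t j) c.
    rewrite (_ : (fun w => _) = (fun w => cos (b * Z i w + L w + c)))//.
    apply/funext => w; congr (cos (_ + _)); rewrite big_cons eqxx; congr (_ + _).
    by apply: eq_big_seq => j; case: eqP => // -> ik; rewrite ik in iks.
  rewrite RintegralB_bounded; last 2 first.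
  - exact: bounded_rvM (bounded_rv_cst _) (bounded_rvD (b1 _ _) (b1 _ _)).
  - exact: bounded_rvM (bounded_rv_cst _) (bounded_rv_cos _ _ (mZ i)).
  rewrite !RintegralZ_bounded; last 2 first.
  - exact: bounded_rv_cos.
  - exact: bounded_rvD.
  rewrite RintegralD_bounded// !IHu cosZi /C sqrrN.
  have -> : - (u ^+ 2 * v i + S) / 2 = - (u ^+ 2 * v i) / 2 + - S / 2 by field.
  by rewrite !cosD cosN sinN expRD; field.
have [_ /(_ _ _ bGC (mZ i) orth)] := hk i.
under eq_Rintegral do rewrite mulrBl.
rewrite RintegralB_bounded; last 2 first.
- exact: bounded_rvM bG (bk i).
- exact: bounded_rvM (bounded_rv_cst _) (bk i).
rewrite RintegralZ_bounded// => /eqP; rewrite subr_eq0 => /eqP h.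
rewrite big_cons -/Q -mulrA -/C mulrC -h; apply: eq_Rintegral => w _.
by rewrite big_cons /G /q /L; ring.
Qed.

Lemma independent_product (k : I -> R -> R) (js : seq I) :
  (forall j, cos_determined (k j)) -> uniq js ->
  \int[P]_w (\prod_(j <- js) k j (Z j w)) = \prod_(j <- js) \int[P]_w k j (Z j w).
Proof.
move=> hk ujs; have := @integral_prod_cos k js [::] (fun=> 0) 0 hk.
rewrite cats0 big_nil cos0 oppr0 mul0r expR0 !mulr1 => <-//.
by apply: eq_Rintegral => w _; rewrite big_nil addr0 cos0 mulr1.
Qed.

End Independence.
End BoundedVariables.

(** * Gaussian fields *)

Section GaussianField.
Variables (R : realType) (V : choiceType) (C : V -> V -> R).
Variables (d : measure_display) (T : measurableType d) (P : probability T R).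
Variable phi : V -> {RV P >-> R}.
Hypothesis gaussian_phi :
  centered_gaussian_field (fun x y => (C x y)%:E) phi.

Definition field_span (U : T -> R) : Prop :=
  exists s a, U = fun w => \sum_(x <- s) a x * phi x w.

Lemma field_span_phi x : field_span (phi x).
Proof.
exists [:: x], (fun=> 1); apply/funext => w.
by rewrite big_seq1 mul1r.
Qed.

Lemma field_spanZ c U : field_span U -> field_span (fun w => c * U w).
Proof.
move=> [s [a ->]]; exists s, (fun x => c * a x); apply/funext => w.
by rewrite mulr_sumr; apply: eq_bigr => x _; rewrite mulrA.
Qed.

(** A list in [field_span] may repeat vertices, so multiplicities enter the coefficients when two
    combinations are merged. *)
Lemma sum_undup (s : seq V) (f : V -> R) :
  \sum_(x <- s) f x = \sum_(x <- undup s) (count_mem x s)%:R * f x.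
Proof.
rewrite -big_undup_iterop_count; apply: eq_bigr => x _.
by rewrite Monoid.iteropE iter_addr_0 mulr_natl.
Qed.

Lemma sum_undup_sub (s t : seq V) (f : V -> R) : {subset s <= t} ->
  \sum_(x <- s) f x = \sum_(x <- undup t) (count_mem x s)%:R * f x.
Proof.
move=> st; rewrite sum_undup [RHS](bigID (mem s))/=.
rewrite [X in _ = _ + X]big1 ?addr0; last first.
  by move=> x xs; rewrite (count_memPn xs) mul0r.
rewrite -[RHS]big_filter; apply: perm_big; apply: uniq_perm.
- exact: undup_uniq.
- by rewrite filter_uniq// undup_uniq.
move=> x; rewrite mem_filter !mem_undup; apply/idP/andP => [xs|[]//].
by split => //; exact: st.
Qed.

Lemma field_spanD U W : field_span U -> field_span W ->
  field_span (fun w => U w + W w).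
Proof.
move=> [s [a ->]] [t [b ->]]; exists (undup (s ++ t)).
exists (fun x => (count_mem x s)%:R * a x + (count_mem x t)%:R * b x).
apply/funext => w; rewrite (@sum_undup_sub s (s ++ t)); last first.
  by move=> x xs; rewrite mem_cat xs.
rewrite (@sum_undup_sub t (s ++ t)); last first.
  by move=> x xt; rewrite mem_cat xt orbT.
by rewrite -big_split; apply: eq_bigr => x _ /=; ring.
Qed.

Lemma field_span_sum (I : Type) (js : seq I) (t : I -> R) (Z : I -> T -> R) :
  (forall j, field_span (Z j)) -> field_span (fun w => \sum_(j <- js) t j * Z j w).
Proof.
move=> hZ; elim: js => [|j js IH].
  by exists [::], (fun=> 0); apply/funext => w; rewrite !big_nil.
under eq_fun do rewrite big_cons.
by apply: field_spanD => //; exact: field_spanZ.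
Qed.

Lemma measurable_field_span U : field_span U -> measurable_fun setT U.
Proof.
move=> [s [a ->]]; elim: s => [|x s IH].
  by under eq_fun do rewrite big_nil; exact: measurable_cst.
under eq_fun do rewrite big_cons; apply: measurable_funD => //.
by apply: measurable_funM; [exact: measurable_cst|exact: measurable_funP].
Qed.

Lemma gaussian_field_span U : field_span U -> gaussian_rv P U.
Proof. by move=> [s [a ->]]; case: gaussian_phi => + _ _; exact. Qed.

Lemma integrable_field_span U : field_span U -> P.-integrable setT (EFin \o U).
Proof.
move=> sU; have mU := measurable_field_span sU.
by have [] := gaussian_rv_L2 mU (gaussian_field_span sU).
Qed.

(** By polarization, since the sum of two elements of the span is again Gaussian, hence square
    integrable. *)
Lemma integrable_field_spanM U W : field_span U -> field_span W ->
  P.-integrable setT (EFin \o (fun w => U w * W w)).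
Proof.
have L2 Y : field_span Y -> P.-integrable setT (EFin \o (fun w => Y w ^+ 2)).
  move=> sY; have mY := measurable_field_span sY.
  by have [] := gaussian_rv_L2 mY (gaussian_field_span sY).
move=> sU sW; have i1 := L2 _ (field_spanD sU sW).
have := integrableZl measurableT (2^-1 : R) (integrableB measurableT i1
  (integrableD measurableT (L2 _ sU) (L2 _ sW))).
apply: eq_integrable => // w _.
rewrite [LHS](_ : _ =
  (2^-1 * ((U w + W w) ^+ 2 - (U w ^+ 2 + W w ^+ 2)))%:E)//.
by congr EFin; field.
Qed.

Lemma field_span_mean U : field_span U -> \int[P]_w U w = 0.
Proof.
move=> [s [a ->]]; case: gaussian_phi => _ E0 _.
elim: s => [|x s IH].
  under eq_Rintegral do rewrite big_nil.
  by rewrite Rintegral_cst// mul0r.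
under eq_Rintegral do rewrite big_cons.
have ix := integrable_field_span (field_span_phi x).
rewrite RintegralD//; last 2 first.
- exact: (integrable_field_span (field_spanZ (a x) (field_span_phi x))).
- by apply: integrable_field_span; exists s, a.
rewrite IH addr0 RintegralZl//.
by have := E0 x; rewrite expectation_def /Rintegral => ->; rewrite mulr0.
Qed.

Lemma field_covariance x y : \int[P]_w (phi x w * phi y w) = C x y.
Proof.
case: gaussian_phi => _ E0 /(_ x y); rewrite unlock !E0 /=.
rewrite unlock /Rintegral => /(congr1 fine) /= <-.
congr fine; apply: eq_integral => w _.
rewrite [in RHS](_ : _ w = (phi x w - 0) * (phi y w - 0))//.
by rewrite !subr0.
Qed.

Definition inner U W : R := \int[P]_w (U w * W w).

Lemma innerC U W : inner U W = inner W U.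
Proof. by rewrite /inner; under eq_Rintegral do rewrite mulrC. Qed.

Lemma innerDl U U' W : field_span U -> field_span U' -> field_span W ->
  inner (fun w => U w + U' w) W = inner U W + inner U' W.
Proof.
move=> sU sU' sW; rewrite /inner; under eq_Rintegral do rewrite mulrDl.
by rewrite RintegralD//; exact: integrable_field_spanM.
Qed.

Lemma innerZl c U W : field_span U -> field_span W ->
  inner (fun w => c * U w) W = c * inner U W.
Proof.
move=> sU sW; rewrite /inner; under eq_Rintegral do rewrite -mulrA.
by rewrite RintegralZl//; exact: integrable_field_spanM.
Qed.

Section Orthogonal.
Variables (I : eqType) (Z : I -> T -> R).
Hypothesis span_Z : forall i, field_span (Z i).
Hypothesis orthogonal_Z : forall i j, i != j -> inner (Z i) (Z j) = 0.

Lemma inner_sum_sqr (js : seq I) (t : I -> R) : uniq js ->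
  let U w := \sum_(j <- js) t j * Z j w in
  inner U U = \sum_(j <- js) t j ^+ 2 * inner (Z j) (Z j).
Proof.
elim: js => [_|i js IH] /=.
  by rewrite /inner big_nil; under eq_Rintegral do rewrite big_nil mul0r;
    rewrite Rintegral_cst// mul0r.
move=> /andP[ijs ujs]; pose L w := \sum_(j <- js) t j * Z j w.
have -> : (fun w => \sum_(j <- i :: js) t j * Z j w) =
    (fun w => t i * Z i w + L w) by apply/funext => w; rewrite big_cons.
have sL : field_span L by exact: field_span_sum.
have sti := field_spanZ (t i) (span_Z i).
have ZL : inner (Z i) L = 0.
  rewrite innerC /L; elim: js ijs {IH ujs L sL} => [_|j js IH].
    by rewrite /inner; under eq_Rintegral do rewrite big_nil mul0r;
      rewrite Rintegral_cst// mul0r.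
  rewrite in_cons negb_or => /andP[ij ijs].
  rewrite (_ : (fun w => _) = (fun w => t j * Z j w +
    \sum_(k <- js) t k * Z k w)); last by apply/funext => w; rewrite big_cons.
  rewrite innerDl//; [|exact: field_spanZ|exact: field_span_sum].
  by rewrite IH// innerZl// orthogonal_Z 1?eq_sym// mulr0 addr0.
have sD := field_spanD sti sL.
rewrite innerDl// innerZl// [inner (Z i) _]innerC innerDl// innerZl//.
rewrite [inner L (Z i)]innerC ZL addr0 [inner L _]innerC innerDl//.
rewrite innerZl// ZL mulr0 add0r big_cons; have /= <- := IH ujs.
by rewrite /L; ring.
Qed.

(** The linear combination is one centered Gaussian variable, whose variance is a sum of squares by
    orthogonality; its transform is taken at t = 1. *)
Lemma orthogonal_cos (js : seq I) (t : I -> R) (th : R) : uniq js ->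
  \int[P]_w cos (\sum_(j <- js) t j * Z j w + th) =
  cos th * expR (- (\sum_(j <- js) t j ^+ 2 * inner (Z j) (Z j)) / 2).
Proof.
move=> ujs; pose U w := \sum_(j <- js) t j * Z j w.
have sU : field_span U by exact: field_span_sum.
have [s [s2 cosU _]] := centered_gaussian_rv (measurable_field_span sU)
  (gaussian_field_span sU) (field_span_mean sU).
have := cosU 1 th; rewrite s2.
have -> : \int[P]_w U w ^+ 2 = inner U U.
  by rewrite /inner; under eq_Rintegral do rewrite expr2.
rewrite inner_sum_sqr// expr1n mulr1 -mulNr => <-.
by apply: eq_Rintegral => w _; rewrite mul1r.
Qed.

End Orthogonal.
End GaussianField.

(** * A two-type branching process *)

(* Words index the vertices of the binary tree, the latest letter first. *)
Definition word := seq bool.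

Fixpoint subtree (n : nat) (w : word) : seq word :=
  if n is m.+1 then w :: subtree m (true :: w) ++ subtree m (false :: w)
  else [::].

Lemma subtree_suffix n w x : x \in subtree n w -> exists u, x = u ++ w.
Proof.
elim: n w => [//|n IH] w /=; rewrite in_cons mem_cat.
case/orP => [/eqP ->|/orP[/IH[u ->]|/IH[u ->]]]; first by exists [::].
  by exists (rcons u true); rewrite cat_rcons.
by exists (rcons u false); rewrite cat_rcons.
Qed.

Lemma uniq_subtree n w : uniq (subtree n w).
Proof.
elim: n w => [//|n IH] w /=; rewrite cat_uniq !IH/= andbT.
apply/andP; split.
  rewrite mem_cat negb_or; apply/andP; split; apply/negP => /subtree_suffix[u].
    by move=> /(congr1 size); rewrite size_cat/=; lia.
  by move=> /(congr1 size); rewrite size_cat/=; lia.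
(* Words from the two branches differ in the letter that precedes the common suffix w. *)
apply/hasPn => x /subtree_suffix[u xu]; apply/negP => /subtree_suffix[v].
rewrite xu -!cat_rcons => /eqP uv; move: (uv).
have : size (rcons u false) = size (rcons v true).
  by move/eqP/(congr1 size): uv; rewrite !size_cat => /addIn.
move=> /eqseq_cat ->; rewrite eqseq_rcons andbC.
by rewrite -[false == true]/false !andbF.
Qed.

Section Branching.
Variables (R : realType) (d : measure_display) (T : measurableType d).
Variables (P : probability T R) (Z : word -> T -> R).
Variables (delta h : R).
Hypotheses (delta_gt0 : 0 < delta) (h_gt0 : 0 < h) (h_lt1 : h < 1).

(** Indicators of the four intervals cut out by - delta, h and 1, written with half-lines so that
    [cos_determined] applies. *)
Definition noise_class (s : 'I_4) (x : R) : R :=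
  match val s with
  | 0 => 1 - (- delta < x)%R%:R
  | 1 => (- delta < x)%R%:R - (h < x)%R%:R
  | 2 => (h < x)%R%:R - (1 < x)%R%:R
  | _ => (1 < x)%R%:R
  end.

(* The type of a vertex: dead (None), phi > h (Some false), phi > 1 (Some true);
   s ranks the noise among the thresholds - delta, h and 1. *)
Definition next_type (t : bool) (s : 'I_4) : option bool :=
  match val s with
  | 0 => None
  | 1 => if t then Some false else None
  | 2 => Some false
  | _ => Some true
  end.

(** The indicator of dying out within n levels, where t is the type of the parent of w and the noise
    at w decides the type of w. It is real-valued so as to enter products and integrals; horizon 0
    counts as survival. *)
Fixpoint extinct n (w : word) (t : bool) (om : T) : R :=
  if n is m.+1 then
    \sum_(s < 4) noise_class s (Z w om) *
      (if next_type t s is Some t' then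
         extinct m (true :: w) t' om * extinct m (false :: w) t' om else 1)
  else 0.

Lemma noise_class01 s x : noise_class s x = 0 \/ noise_class s x = 1.
Proof.
have d0 := delta_gt0; have h0 := h_gt0; have h1 := h_lt1.
have lt1 : h < x -> - delta < x by move=> hx; lra.
have lt2 : 1 < x -> h < x by move=> hx; lra.
case: s => [[|[|[|[|//]]]] s4]; rewrite /noise_class/=.
- by case: (_ < _); [left|right] => /=; lra.
- have [/lt1 ->|_] := boolP (h < x); first by left => /=; lra.
  by case: (_ < _); [right|left] => /=; lra.
- have [/lt2 ->|_] := boolP (1 < x); first by left => /=; lra.
  by case: (_ < _); [right|left] => /=; lra.
- by case: (_ < _); [right|left].
Qed.

Lemma sum_noise_class x : \sum_(s < 4) noise_class s x = 1.
Proof. by rewrite !big_ord_recr big_ord0 /noise_class/=; ring. Qed.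

Lemma noise_class_ge0 s x : 0 <= noise_class s x.
Proof. by have [->|->] := noise_class01 s x. Qed.

Lemma extinct_itv n w t om : 0 <= extinct n w t om <= 1.
Proof.
elim: n w t => [|n IH] w t /=; first by rewrite lexx ler01.
apply/andP; split.
  apply: sumr_ge0 => s _; rewrite mulr_ge0 ?noise_class_ge0//.
  case: next_type => // t'; rewrite mulr_ge0//.
    by have /andP[] := IH (true :: w) t'.
  by have /andP[] := IH (false :: w) t'.
rewrite -[leRHS](sum_noise_class (Z w om)); apply: ler_sum => s _.
rewrite ler_piMr ?noise_class_ge0//; case: next_type => // t'.
have /andP[? ?] := IH (true :: w) t'; have /andP[? ?] := IH (false :: w) t'.
exact: mulr_ile1.
Qed.

Lemma noise_class_cos_determined s : cos_determined P (noise_class s).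
Proof.
have hl := cos_determined_halfline P.
case: s => [[|[|[|[|//]]]] s4]; rewrite /noise_class/=.
- exact: cos_determinedB (cos_determined_cst P 1) (hl _).
- exact: cos_determinedB.
- exact: cos_determinedB.
- exact: hl.
Qed.

Hypothesis mZ : forall w, measurable_fun setT (Z w).
Hypothesis indep_Z : forall (k : word -> R -> R) (js : seq word),
  (forall j, cos_determined P (k j)) -> uniq js ->
  \int[P]_om (\prod_(j <- js) k j (Z j om)) = \prod_(j <- js) \int[P]_om k j (Z j om).

Lemma bounded_noise_class s w : bounded_rv (fun om => noise_class s (Z w om)).
Proof.
have [[mk [A kA]] _] := noise_class_cos_determined s.
exact: bounded_rv_comp kA.
Qed.

Lemma bounded_rv_sum (I : Type) (r : seq I) (f : I -> T -> R) :
  (forall i, bounded_rv (f i)) -> bounded_rv (fun om => \sum_(i <- r) f i om).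
Proof.
move=> bf; elim: r => [|i r IH].
  by under eq_fun do rewrite big_nil; exact: bounded_rv_cst.
by under eq_fun do rewrite big_cons; exact: bounded_rvD.
Qed.

Lemma bounded_rv_prod (I : Type) (r : seq I) (f : I -> T -> R) :
  (forall i, bounded_rv (f i)) -> bounded_rv (fun om => \prod_(i <- r) f i om).
Proof.
move=> bf; elim: r => [|i r IH].
  by under eq_fun do rewrite big_nil; exact: bounded_rv_cst.
by under eq_fun do rewrite big_cons; exact: bounded_rvM.
Qed.

Lemma Rintegral_sum_bounded (I : Type) (r : seq I) (f : I -> T -> R) :
  (forall i, bounded_rv (f i)) ->
  \int[P]_om (\sum_(i <- r) f i om) = \sum_(i <- r) \int[P]_om f i om.
Proof.
move=> bf; elim: r => [|i r IH].
  under eq_Rintegral do rewrite big_nil.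
  by rewrite big_nil Rintegral_cst_probability.
under eq_Rintegral do rewrite big_cons.
by rewrite big_cons RintegralD_bounded ?IH//; exact: bounded_rv_sum.
Qed.

Lemma bounded_extinct n w t : bounded_rv (extinct n w t).
Proof.
elim: n w t => [|n IH] w t; first exact: bounded_rv_cst.
apply: bounded_rv_sum => s; apply: (bounded_rvM (bounded_noise_class s w)).
case: next_type => [t'|]; last exact: bounded_rv_cst.
exact: bounded_rvM.
Qed.

Definition class_prob (s : 'I_4) w : R := \int[P]_om noise_class s (Z w om).

Lemma class_prob_ge0 s w : 0 <= class_prob s w.
Proof. by apply: Rintegral_ge0 => om _; exact: noise_class_ge0. Qed.

(** [U] is a supersolution of the extinction recursion. As [extinct] starts from 0, [U] bounds the
    extinction probabilities at every horizon. The root is left out because its noise is revealed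
    separately. *)
Variable U : bool -> R.
Hypothesis U_ge0 : forall t, 0 <= U t.
Hypothesis U_super : forall w t, w != [::] ->
  \sum_(s < 4) class_prob s w *
    (if next_type t s is Some t' then U t' * U t' else 1) <= U t.

(** (w, n, t) is the subtree of height n at w, below a parent of type t. *)
Definition item := (word * nat * bool)%type.

Definition item_subtree (i : item) := subtree i.1.2 i.1.1.
Definition item_extinct (i : item) := extinct i.1.2 i.1.1 i.2.

(* Joint law of the already revealed noises js and of the extinction of the
   independent subtrees listed in st, revealing one noise at a time. *)
Lemma extinct_forest_le (st : seq item) (js : seq word) (sg : word -> 'I_4) :
  uniq (js ++ flatten (map item_subtree st)) ->
  all (fun i : item => i.1.1 != [::]) st ->
  \int[P]_om ((\prod_(j <- js) noise_class (sg j) (Z j om)) *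
              \prod_(i <- st) item_extinct i om) <=
  (\prod_(j <- js) class_prob (sg j) j) * \prod_(i <- st) U i.2.
Proof.
(* Induction on the number of noises still to be revealed. *)
have [m] := ubnP (size (flatten (map item_subtree st))).
have bj ls sg' : bounded_rv
    (fun om => \prod_(j <- ls) noise_class (sg' j) (Z j om)).
  by apply: bounded_rv_prod => j; exact: bounded_noise_class.
have bs ls : bounded_rv (fun om => \prod_(i <- ls) item_extinct i om).
  by apply: bounded_rv_prod => i; exact: bounded_extinct.
elim: m st js sg => // m IH [|[[w [|n]] t] st] js sg.
- move=> _; rewrite /= cats0 => ujs _; rewrite big_nil mulr1.
  under eq_Rintegral do rewrite big_nil mulr1.
  rewrite (indep_Z (k := fun j => noise_class (sg j)))// => j.
  exact: noise_class_cos_determined.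
(* A subtree of height 0 is never extinct, so the integral is 0. *)
- move=> _ _ _; under eq_Rintegral do rewrite big_cons /item_extinct/= mul0r mulr0.
  rewrite Rintegral_cst_probability mulr_ge0//.
    by apply: prodr_ge0 => j _; exact: class_prob_ge0.
  by apply: prodr_ge0.
rewrite /= /item_subtree/= ltnS => sz uj /andP[w0 st0].
set tl := subtree n (true :: w) in sz uj; set fl := subtree n (false :: w) in sz uj.
have wjs : w \notin js.
  move: uj; rewrite cat_uniq => /and3P[_ + _] => /hasPn/(_ w).
  by rewrite mem_head => /(_ isT).
have uj' : uniq (w :: js ++ (tl ++ fl) ++ flatten (map item_subtree st)).
  by move: uj; rewrite -cat1s uniq_catCA.
have prodE s om : \prod_(j <- w :: js)
    noise_class (if j == w then s else sg j) (Z j om) =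
    noise_class s (Z w om) * \prod_(j <- js) noise_class (sg j) (Z j om).
  rewrite big_cons eqxx; congr (_ * _); apply: eq_big_seq => j jjs.
  by case: eqP => // jw; rewrite -jw jjs in wjs.
have prodqE s : \prod_(j <- w :: js) class_prob (if j == w then s else sg j) j =
    class_prob s w * \prod_(j <- js) class_prob (sg j) j.
  rewrite big_cons eqxx; congr (_ * _); apply: eq_big_seq => j jjs.
  by case: eqP => // jw; rewrite -jw jjs in wjs.
pose X (s : 'I_4) om := noise_class s (Z w om) *
  (\prod_(j <- js) noise_class (sg j) (Z j om)) *
  ((if next_type t s is Some t' then
     extinct n (true :: w) t' om * extinct n (false :: w) t' om else 1) *
   \prod_(i <- st) item_extinct i om).
have bX s : bounded_rv (X s).
  apply: bounded_rvM; first exact: bounded_rvM (bounded_noise_class s w) (bj js sg).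
  apply: bounded_rvM; last exact: bs.
  case: next_type => [t'|]; last exact: bounded_rv_cst.
  by apply: bounded_rvM; exact: bounded_extinct.
have -> : \int[P]_om ((\prod_(j <- js) noise_class (sg j) (Z j om)) *
    \prod_(i <- (w, n.+1, t) :: st) item_extinct i om) =
    \sum_(s < 4) \int[P]_om X s om.
  rewrite -Rintegral_sum_bounded//; apply: eq_Rintegral => om _.
  rewrite big_cons {1}/item_extinct/= mulrCA mulr_suml; apply: eq_bigr => s _.
  by rewrite /X mulrACA.
rewrite big_cons /=.
apply: (@le_trans _ _ (\sum_(s < 4) (\prod_(j <- js) class_prob (sg j) j) *
  (class_prob s w * (if next_type t s is Some t' then U t' * U t' else 1)) *
  \prod_(i <- st) U i.2)); last first.
  rewrite -mulr_suml -mulr_sumr [leRHS]mulrA ler_wpM2r//.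
    by apply: prodr_ge0.
  rewrite ler_wpM2l ?U_super//.
  by apply: prodr_ge0 => j _; exact: class_prob_ge0.
apply: ler_sum => s _.
pose sg' j := if j == w then s else sg j.
rewrite /X; case: (next_type t s) => [t'|].
  (* w joins the revealed noises and its two child subtrees, with parent type t', join the
     forest. *)
  have := IH ((true :: w, n, t') :: (false :: w, n, t') :: st) (w :: js) sg'.
  rewrite /= /item_subtree/= -/tl -/fl -/item_subtree prodqE !big_cons/=.
  rewrite !catA in sz uj' *.
  move=> /(_ sz uj' st0); rewrite mulrA => h1.
  rewrite [leRHS](_ : _ = class_prob s w *
    \prod_(j <- js) class_prob (sg j) j * (U t' * (U t' * \prod_(i <- st) U i.2)));
    last by ring.
  rewrite -[leRHS]mulrA in h1 *.
  apply: le_trans h1; rewrite le_eqVlt; apply/orP; left; apply/eqP.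
  apply: eq_Rintegral => om _; rewrite prodE !big_cons /item_extinct/=.
  by rewrite -!mulrA.
(* w is dead: its extinction factor is 1 and its descendants are discarded. *)
have := IH st (w :: js) sg'; rewrite prodqE.
have sz' : (size (flatten [seq item_subtree i | i <- st]) < m)%N.
  by apply: leq_ltn_trans sz; rewrite [leqRHS]size_cat leq_addl.
have uj2 : uniq ((w :: js) ++ flatten [seq item_subtree i | i <- st]).
  move: uj'; rewrite -(cat1s w js) -catA; apply: subseq_uniq.
  rewrite /= eqxx; apply: cat_subseq => //.
  by rewrite (catA tl); exact: suffix_subseq.
move=> /(_ sz' uj2 st0) h1.
rewrite mulr1 [leRHS](_ : _ = class_prob s w *
    \prod_(j <- js) class_prob (sg j) j * \prod_(i <- st) U i.2); last by ring.
apply: le_trans h1; rewrite le_eqVlt; apply/orP; left; apply/eqP.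
by apply: eq_Rintegral => om _; rewrite prodE mul1r.
Qed.

Lemma survival_ge n (s : 'I_4) :
  class_prob s [::] * (1 - U true * U true) <=
  \int[P]_om (noise_class s (Z [::] om) *
    (1 - extinct n [:: true] true om * extinct n [:: false] true om)).
Proof.
have := @extinct_forest_le [:: ([:: true], n, true); ([:: false], n, true)]
  [:: [::]] (fun=> s).
rewrite /= cats0 /item_subtree/=.
have u2 : uniq (subtree n [:: true] ++ subtree n [:: false]).
  by have := uniq_subtree n.+1 [::]; rewrite /= => /andP[].
rewrite u2 andbT (_ : [::] \notin _) => [/(_ isT isT)|]; last first.
  by have := uniq_subtree n.+1 [::]; rewrite /= => /andP[].
rewrite !big_cons !big_nil !mulr1 /= => h1.
have bn := bounded_noise_class s [::].
have be := bounded_rvM (bounded_extinct n [:: true] true)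
  (bounded_extinct n [:: false] true).
apply: (@le_trans _ _ (class_prob s [::] - \int[P]_om (noise_class s (Z [::] om) *
   (extinct n [:: true] true om * extinct n [:: false] true om)))).
  rewrite mulrBr mulr1 lerB//; apply: le_trans h1.
  rewrite le_eqVlt; apply/orP; left; apply/eqP; apply: eq_Rintegral => om _.
  by rewrite !big_cons !big_nil !mulr1.
rewrite /class_prob -RintegralB_bounded//; last exact: bounded_rvM.
rewrite le_eqVlt; apply/orP; left; apply/eqP; apply: eq_Rintegral => om _.
by rewrite mulrBr mulr1.
Qed.

End Branching.

Section BranchingConstants.
Variable R : realType.

(** With A = 1 - (1 - a)^2 and D = (1 - a)^2 - (1 - b)^2, the left sides are 1 - (q A + q1 D) for q
    = qh and q = qd. In the first case q A falls short of a by at most a^2, and q1 D >= p a g = a^2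
    makes up for it: hence a = p g. In the second case q A alone reaches b. *)
Lemma branching_super_inequality (p g qd qh q1 : R) (a := p * g) (b := a * (1 + g)) :
  0 < p <= 2^-1 -> 0 < g <= 2^-1 -> p <= q1 -> q1 <= qh ->
  2^-1 - a / 4 <= qh -> 2^-1 + g <= qd ->
  (1 - qh) + (qh - q1) * (1 - a) ^+ 2 + q1 * (1 - b) ^+ 2 <= 1 - a /\
  (1 - qd) + (qd - q1) * (1 - a) ^+ 2 + q1 * (1 - b) ^+ 2 <= 1 - b.
Proof.
move=> /andP[p0 p1] /andP[g0 g1] pq qq hh hd.
have a0 : 0 < a by rewrite /a mulr_gt0.
have ag : a <= g / 2 by rewrite /a; nra.
have a1 : a <= 4^-1 by lra.
have bE : b - a = a * g by rewrite /b; ring.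
have ab : a <= b by nra.
have b1 : b <= 1 / 2 by nra.
pose A := a * (2 - a); pose D := (b - a) * (2 - a - b).
have ag0 : 0 <= a * g by rewrite mulr_ge0// ltW.
have aD : a * g <= D by rewrite /D bE -[leLHS]mulr1 ler_wpM2l//; lra.
have D0 : p * (a * g) <= q1 * D.
  apply: (@le_trans _ _ (p * D)); first by rewrite ler_pM2l.
  by rewrite ler_wpM2r//; lra.
have A0 : 0 <= A by rewrite /A; nra.
have h1 : a * (1 - a) <= qh * A.
  apply: (@le_trans _ _ ((2^-1 - a / 4) * A)); last by rewrite ler_wpM2r.
  by rewrite /A; nra.
have h2 : a * (1 + g) <= qd * A.
  apply: (@le_trans _ _ ((2^-1 + g) * A)); last by rewrite ler_wpM2r.
  have : 0 <= a * (g - a / 2 - a * g) by apply: mulr_ge0; nra.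
  by rewrite /A; nra.
have pg : p * (a * g) = a * a by rewrite /a; ring.
split.
  have -> : 1 - qh + (qh - q1) * (1 - a) ^+ 2 + q1 * (1 - b) ^+ 2 =
    1 - (qh * A + q1 * D) by rewrite /A /D; ring.
  by lra.
have -> : 1 - qd + (qd - q1) * (1 - a) ^+ 2 + q1 * (1 - b) ^+ 2 =
  1 - (qd * A + q1 * D) by rewrite /A /D; ring.
have : 0 <= p * (a * g) by rewrite pg mulr_ge0// ltW.
by rewrite -[b]/(a * (1 + g)); lra.
Qed.

End BranchingConstants.

Lemma sum_ord4 (R : nmodType) (F : 'I_4 -> R) :
  \sum_(s < 4) F s = F (@Ordinal 4 0 isT) + F (@Ordinal 4 1 isT) +
    F (@Ordinal 4 2 isT) + F (@Ordinal 4 3 isT).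
Proof.
rewrite !big_ord_recl big_ord0 addr0 !addrA.
by congr (_ + _ + _ + _); congr F; exact: val_inj.
Qed.

(** * Comparison of the level set with the branching process *)

Section Percolation.
Variables (R : realType) (d : measure_display) (T : measurableType d).
Variables (P : probability T R) (Z : word -> T -> R).
Hypothesis mZ : forall w, measurable_fun setT (Z w).
Hypothesis indep_Z : forall (k : word -> R -> R) (js : seq word),
  (forall j, cos_determined P (k j)) -> uniq js ->
  \int[P]_om (\prod_(j <- js) k j (Z j om)) = \prod_(j <- js) \int[P]_om k j (Z j om).

Variables (a : word -> R) (psi : word -> T -> R) (delta h : R).
Hypotheses (h_gt0 : 0 < h) (h_lt1 : h < 1) (h_le_delta : h <= delta).
Hypothesis a_ge : forall w, w != [::] -> 2 * delta <= a w.
Hypothesis psi_root : psi [::] = Z [::].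
Hypothesis psi_child : forall b w om,
  psi (b :: w) om = a (b :: w) * psi w om + Z (b :: w) om.

Let delta_gt0 : 0 < delta. Proof. exact: lt_le_trans h_gt0 h_le_delta. Qed.

(** A chain of n vertices, descending from w, lies above h; these finite-horizon events decrease
    with n. *)
Fixpoint alive n (w : word) (om : T) : Prop :=
  if n is m.+1 then h < psi w om /\ (alive m (true :: w) om \/ alive m (false :: w) om)
  else True.

Local Notation extinct := (extinct Z delta h).
Local Notation noise_class := (noise_class delta h).

(** A surviving branching process forces a surviving chain: a parent above h > 0 contributes a
    nonnegative mean, so the child is at least its noise; a parent above 1 contributes more than 2
    delta. *)
Lemma aliveP n b w t om : (if t then 1 < psi w om else h < psi w om) ->
  extinct n (b :: w) t om != 1 -> alive n (b :: w) om.
Proof.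
have h0 := h_gt0; have h1 := h_lt1; have hd := h_le_delta.
elim: n b w t => [//|n IH] b w t psiw /=.
set z := Z (b :: w) om.
have ha : 2 * delta <= a (b :: w) by exact: a_ge.
have psiE := psi_child b w om; rewrite -/z in psiE.
rewrite !big_ord_recl big_ord0 /bump/= /noise_class/=.
rewrite /bump/= /next_type/= addr0.
move=> ext1.
have step (t' : bool) : (if t' then 1 < psi (b :: w) om else h < psi (b :: w) om) ->
    h < psi (b :: w) om ->
    extinct n (true :: b :: w) t' om * extinct n (false :: b :: w) t' om != 1 ->
    h < psi (b :: w) om /\ (alive n (true :: b :: w) om \/ alive n (false :: b :: w) om).
  move=> psit hpsi e1; split => //.
  have [e2|e2] := eqVneq (extinct n (true :: b :: w) t' om) 1.
    by right; apply: (IH _ _ t') => //; rewrite e2 mul1r in e1.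
  by left; apply: (IH _ _ t').
have [z3|z3] := ltP 1 z.
  have z2 : h < z by lra.
  have z1 : - delta < z by lra.
  have ap : 0 <= a (b :: w) * psi w om.
    by apply: mulr_ge0; [lra|case: (t) psiw => ?; lra].
  apply: (step true); [by rewrite psiE; lra..|].
  by move: ext1; rewrite z3 z2 z1 /= !subrr !mul0r !add0r mul1r.
have [z2|z2] := ltP h z.
  have z1 : - delta < z by lra.
  have ap : 0 <= a (b :: w) * psi w om.
    by apply: mulr_ge0; [lra|case: (t) psiw => ?; lra].
  apply: (step false); [by rewrite psiE; lra..|].
  move: ext1; rewrite z2 z1 (le_gtF z3)/=.
  by rewrite !subrr !mul0r !add0r subr0 mul1r addr0.
have [z1|z1] := ltP (- delta) z; last first.
  move: ext1; rewrite (le_gtF z1) (le_gtF z2) (le_gtF z3)/=.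
  by rewrite !subr0 !mul0r !addr0 mul1r eqxx.
move: ext1; rewrite z1 (le_gtF z2) (le_gtF z3)/= !subrr !subr0 !mul0r !addr0 add0r mul1r.
case: t psiw => psiw; last by rewrite eqxx.
(* Mean above 2 delta and noise above - delta leave the child above delta, hence above h. *)
have ap : 2 * delta < a (b :: w) * psi w om.
  by apply: (le_lt_trans ha); rewrite ltr_pMr; [exact: psiw|lra].
by apply: (step false); rewrite psiE; lra.
Qed.

Lemma measurable_psi w : measurable_fun setT (psi w).
Proof.
elim: w => [|b w IH]; first by rewrite psi_root.
rewrite (_ : psi (b :: w) = fun om => a (b :: w) * psi w om + Z (b :: w) om).
  apply: measurable_funD => //; apply: measurable_funM => //.
by apply/funext => om.
Qed.

Lemma measurable_alive n w : measurable [set om | alive n w om].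
Proof.
elim: n w => [|n IH] w /=; first by rewrite (_ : [set _ | _] = setT) ?set_true.
rewrite (_ : [set _ | _] = [set om | h < psi w om] `&`
  ([set om | alive n (true :: w) om] `|` [set om | alive n (false :: w) om]))//.
apply: measurableI; last exact: measurableU.
rewrite (_ : [set _ | _] = psi w @^-1` `]h, +oo[%classic).
  by rewrite -[X in measurable X]setTI; apply: measurable_psi.
by apply/seteqP; split => om /=; rewrite in_itv/= andbT.
Qed.

Definition tail w c : R := \int[P]_om (c < Z w om)%R%:R.

Lemma bounded_tail w c : bounded_rv (fun om => (c < Z w om)%R%:R : R).
Proof.
apply: (bounded_rv_comp (k := fun x => (c < x)%R%:R) (M := 1) (mZ w)).
  exact: measurable_halfline.
by move=> x; case: (_ < _); rewrite ?normr1 ?normr0.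
Qed.

Lemma tail_le w c c' : c <= c' -> tail w c' <= tail w c.
Proof.
move=> cc'; apply: le_Rintegral => //.
- exact: bounded_rv_integrable (bounded_tail w c').
- exact: bounded_rv_integrable (bounded_tail w c).
- by move=> om _; rewrite ler_nat; have [/(le_lt_trans cc') ->|] := boolP (c' < _).
Qed.

Variables (p g : R).
Hypotheses (p_itv : 0 < p <= 2^-1) (g_itv : 0 < g <= 2^-1).
Hypothesis tail1 : forall w, w != [::] -> p <= tail w 1.
Hypothesis tailh : forall w, w != [::] -> 2^-1 - p * g / 4 <= tail w h.
Hypothesis taild : forall w, w != [::] -> 2^-1 + g <= tail w (- delta).

Let U (t : bool) : R := if t then 1 - p * g * (1 + g) else 1 - p * g.

Lemma alive_probability n :
  ((tail [::] 1 * (p * g))%:E <= P [set om | alive n.+1 [::] om])%E.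
Proof.
have h0 := h_gt0; have h1 := h_lt1; have hd := h_le_delta; have d0 := delta_gt0.
have /andP[p0 p1] := p_itv; have /andP[g0 g1] := g_itv.
have pg0 : 0 < p * g by rewrite mulr_gt0.
have pgb : p * g * (1 + g) <= 1 by nra.
have U0 t : 0 <= U t by case: t; rewrite /U subr_ge0//; nra.
have cE : forall w, [/\ class_prob P Z delta h (@Ordinal 4 0 isT) w = 1 - tail w (- delta),
    class_prob P Z delta h (@Ordinal 4 1 isT) w = tail w (- delta) - tail w h,
    class_prob P Z delta h (@Ordinal 4 2 isT) w = tail w h - tail w 1 &
    class_prob P Z delta h (@Ordinal 4 3 isT) w = tail w 1].
  move=> w; rewrite /class_prob /noise_class/=; split => //.
  - rewrite RintegralB_bounded//; [|exact: bounded_rv_cst|exact: bounded_tail].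
    by rewrite Rintegral_cst_probability.
  - by rewrite RintegralB_bounded//; exact: bounded_tail.
  - by rewrite RintegralB_bounded//; exact: bounded_tail.
have Us w t : w != [::] -> \sum_(s < 4) class_prob P Z delta h s w *
    (if next_type t s is Some t' then U t' * U t' else 1) <= U t.
  move=> w0; have [c0 c1 c2 c3] := cE w.
  have hlt : h <= 1 by lra.
  have [] := branching_super_inequality p_itv g_itv (tail1 w0) (tail_le w hlt)
    (tailh w0) (taild w0).
  move=> i1 i2; rewrite sum_ord4 c0 c1 c2 c3 /next_type/=.
  case: t; rewrite /U.
    by apply: le_trans i2; rewrite le_eqVlt; apply/orP; left; apply/eqP; ring.
  by apply: le_trans i1; rewrite le_eqVlt; apply/orP; left; apply/eqP; ring.
have [_ _ _ c3] := cE [::].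
(* Class 3 means that the noise at the root exceeds 1, hence so does [psi]: both children have a
   parent of type true. *)
have := survival_ge delta_gt0 h_gt0 h_lt1 mZ indep_Z U0 Us n (@Ordinal 4 3 isT).
rewrite c3.
set I := \int[P]_om _ => sv.
have t0 : 0 <= tail [::] 1 by apply: Rintegral_ge0 => om _.
apply: (@le_trans _ _ I%:E).
  (* With b = p g (1 + g) <= 1, the survival bound is 1 - (1 - b)^2 = b (2 - b) >= b >= p g. *)
  rewrite lee_fin; apply: le_trans sv; rewrite ler_wpM2l// /U.
  have : p * g <= p * g * (1 + g) by rewrite ler_peMr ?(ltW pg0)//; lra.
  by move: (p * g * (1 + g)) pgb => b b1 ab; nra.
have mA := measurable_alive n.+1 [::].
have -> : P [set om | alive n.+1 [::] om] =
    (\int[P]_om \1_[set om | alive n.+1 [::] om] om)%:E.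
  rewrite /Rintegral integral_indic// setIT fineK//.
  exact: fin_num_measure.
rewrite lee_fin; apply: le_Rintegral => //.
- apply: bounded_rv_integrable; apply: bounded_rvM.
    exact: bounded_noise_class.
  apply: bounded_rvB; first exact: bounded_rv_cst.
  by apply: bounded_rvM; exact: bounded_extinct.
- by apply: bounded_rv_integrable; split; [exact: measurable_indic|exists 1 => om;
    rewrite indicE; case: (_ \in _); rewrite ?normr1 ?normr0].
move=> om _; rewrite indicE /noise_class/=.
have e01 b : 0 <= extinct n [:: b] true om <= 1 by exact: extinct_itv.
have /andP[et0 et1] := e01 true; have /andP[ef0 ef1] := e01 false.
have [z1|] := boolP (1 < Z [::] om); last by rewrite mul0r.
rewrite mul1r; have [e1|e1] := eqVneq
    (extinct n [:: true] true om * extinct n [:: false] true om) 1.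
  by rewrite e1 subrr.
rewrite mem_set; first by rewrite lerBlDr lerDl mulr_ge0.
rewrite /= psi_root; split; first by lra.
have [e2|e2] := eqVneq (extinct n [:: true] true om) 1.
  right; apply: (@aliveP _ _ _ true); first by rewrite psi_root.
  by rewrite e2 mul1r in e1.
by left; apply: (@aliveP _ _ _ true); first by rewrite psi_root.
Qed.

End Percolation.

(** * Tails of centered normal laws *)

Section NormalTails.
Variable R : realType.
Local Notation mu := (@lebesgue_measure R).

Lemma normal_peak_anti (x y : R) : 0 < x ^+ 2 -> x ^+ 2 <= y ^+ 2 ->
  normal_peak y <= normal_peak x.
Proof.
move=> x0 xy; have pi0 := pi_gt0 R.
have pos (z : R) : 0 < z ^+ 2 -> 0 < z ^+ 2 * pi *+ 2.
  by move=> z0; rewrite pmulrn_lgt0// mulr_gt0.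
have y0 := lt_le_trans x0 xy.
rewrite /normal_peak lef_pV2 ?posrE ?sqrtr_gt0 ?pos//.
by rewrite ler_wsqrtr// lerMn2r/= ler_wpM2r ?(ltW pi0).
Qed.

Section FixedVariance.
Variables (s v0 : R).
Hypotheses (s_neq0 : s != 0) (v0_gt0 : 0 < v0) (s_itv : v0 <= s ^+ 2 <= 1).
Local Notation p := (normal_pdf 0 s).

Let N : probability (measurableTypeR R) R := normal_prob 0 s.

Lemma normal_peak_ge : normal_peak 1 <= normal_peak s.
Proof.
have /andP[s0 s1] := s_itv; apply: normal_peak_anti; last by rewrite expr1n.
exact: lt_le_trans s0.
Qed.

Lemma normal_peak_le : normal_peak s <= normal_peak (Num.sqrt v0).
Proof.
have /andP[s0 _] := s_itv.
by apply: normal_peak_anti; rewrite sqr_sqrtr ?(ltW v0_gt0).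
Qed.

(** The upper bound on the variance controls the peak, the lower bound controls the exponential; the
    result does not depend on s. *)
Lemma normal_pdf_ge (b x : R) : `|x| <= b ->
  normal_peak 1 * expR (- (b ^+ 2 / (2 * v0))) <= p x.
Proof.
move=> xb; have /andP[s0 _] := s_itv.
have s2 : 0 < s ^+ 2 by rewrite exprn_even_gt0.
rewrite normal_pdfE// ler_pM ?normal_peak_ge0 ?expR_ge0 ?normal_peak_ge//.
rewrite /normal_fun ler_expR subr0 mulNr lerN2.
rewrite ler_pM ?sqr_ge0 ?invr_ge0 ?mulrn_wge0 ?sqr_ge0//.
  by rewrite -(real_normK (num_real x)) lerXn2r ?nnegrE// (le_trans _ xb).
by rewrite -[_ *+ 2]mulr_natl lef_pV2 ?ler_pM2l// posrE mulr_gt0.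
Qed.

Lemma normal_prob_itv_ge (a b c : R) : a <= b -> (forall x, a <= x <= b -> c <= p x) ->
  0 <= c -> (((b - a) * c)%:E <= N `]a, b[%classic)%E.
Proof.
move=> ab cp c0; rewrite /N /normal_prob.
have -> : (((b - a) * c)%:E = \int[mu]_(x in `]a, b[) c%:E)%E.
  rewrite integral_cst//= lebesgue_measure_itv/= lte_fin.
  rewrite mulrC EFinM; move: ab; rewrite le_eqVlt => /orP[/eqP ->|->].
    by rewrite ltxx subrr.
  by rewrite -EFinB.
apply: ge0_le_integral => //.
- by apply/measurable_EFinP; apply: measurable_funTS; exact: measurable_normal_pdf.
- move=> x; rewrite /= in_itv/= => /andP[ax xb]; rewrite lee_fin cp//.
  by rewrite !ltW.
Qed.

Lemma normal_prob_itv_le (a b : R) : a <= b ->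
  (N `[a, b]%classic <= ((b - a) * normal_peak s)%:E)%E.
Proof.
move=> ab; rewrite /N /normal_prob.
have -> : (((b - a) * normal_peak s)%:E = \int[mu]_(x in `[a, b]) (normal_peak s)%:E)%E.
  rewrite integral_cst//= lebesgue_measure_itv/= lte_fin.
  rewrite mulrC EFinM; move: ab; rewrite le_eqVlt => /orP[/eqP ->|->].
    by rewrite ltxx subrr.
  by rewrite -EFinB.
apply: ge0_le_integral => //.
- by move=> x _; rewrite lee_fin normal_pdf_ge0.
- by apply/measurable_EFinP; apply: measurable_funTS; exact: measurable_normal_pdf.
- by move=> x _; rewrite lee_fin normal_pdf_ub.
Qed.

Lemma normal_prob_ge0 : N `[0, +oo[%classic = (2^-1)%:E.
Proof.
have := integral_normal_pdf 0 s; rewrite ge0_symfun_integralT; first last.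
- by move=> x; rewrite /= !normal_pdfE// /normal_fun !subr0 sqrrN.
- exact: continuous_normal_pdf.
- by move=> x; exact: normal_pdf_ge0.
rewrite (_ : [set x | _] = `[0, +oo[%classic); last first.
  by apply/seteqP; split => x/=; rewrite in_itv/= andbT.
rewrite -[X in (_ * X)%E]/(N `[0, +oo[%classic).
have Nf : N `[0, +oo[%classic \is a fin_num by rewrite fin_num_measure.
rewrite -(fineK Nf) -EFinM => -[h]; congr EFin.
by lra.
Qed.

(** By symmetry [0, +oo) has mass 1/2, and [0, h] carries at most h times the largest peak allowed
    by the variance bound. *)
Lemma normal_prob_gt_ge (h : R) : 0 < h ->
  2^-1 - h * normal_peak (Num.sqrt v0) <= fine (N `]h, +oo[%classic).
Proof.
move=> h0; have U : `[0, +oo[%classic = `[0, h]%classic `|` `]h, +oo[%classic :> set R.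
  apply/seteqP; split => x /=; rewrite !in_itv/= ?andbT.
    by move=> x0; have [xh|hx] := leP x h; [left|right] => //; rewrite x0.
  by move=> [/andP[]//|/ltW]; apply: le_trans; exact: ltW.
have dis : `[0, h]%classic `&` `]h, +oo[%classic = set0 :> set R.
  apply/seteqP; split => // x [] /=; rewrite !in_itv/= => /andP[_ xh].
  by rewrite andbT ltNge xh.
have f1 : N `[0, h]%classic \is a fin_num by rewrite fin_num_measure.
have f2 : N `]h, +oo[%classic \is a fin_num by rewrite fin_num_measure.
have e1 : fine (N `[0, h]%classic) + fine (N `]h, +oo[%classic) = 2^-1.
  rewrite -fineD// -[RHS]/(fine (2^-1)%:E) -normal_prob_ge0 U.
  by congr fine; apply/esym; exact: measureU.
have := normal_prob_itv_le (ltW h0); rewrite subr0 -[N _]fineK// lee_fin => le1.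
have : h * normal_peak s <= h * normal_peak (Num.sqrt v0).
  by rewrite ler_pM2l// normal_peak_le.
by lra.
Qed.

Lemma normal_prob_gtN_ge (h : R) : 0 < h ->
  2^-1 + h * (normal_peak 1 * expR (- (h ^+ 2 / (2 * v0)))) <= fine (N `]- h, +oo[%classic).
Proof.
move=> h0; have U : `]- h, +oo[%classic = `]- h, 0[%classic `|` `[0, +oo[%classic :> set R.
  apply/seteqP; split => x /=; rewrite !in_itv/= ?andbT.
    by move=> x0; have [xh|hx] := leP 0 x; [right|left] => //; rewrite x0.
  by move=> [/andP[]//|]; apply: lt_le_trans; rewrite oppr_lt0.
have dis : `]- h, 0[%classic `&` `[0, +oo[%classic = set0 :> set R.
  apply/seteqP; split => // x [] /=; rewrite !in_itv/= => /andP[_ xh].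
  by rewrite andbT leNgt xh.
have f1 : N `]- h, 0[%classic \is a fin_num by rewrite fin_num_measure.
have -> : fine (N `]- h, +oo[%classic) = fine (N `]- h, 0[%classic) + 2^-1.
  rewrite -[2^-1]/(fine (2^-1)%:E) -normal_prob_ge0 -fineD//; last first.
    by rewrite fin_num_measure.
  by rewrite U; congr fine; exact: measureU.
rewrite addrC lerD2r.
set c := normal_peak 1 * _.
have hN : - h <= 0 by rewrite oppr_le0 ltW.
have := @normal_prob_itv_ge (- h) 0 c hN; rewrite sub0r opprK.
move=> itv_ge; rewrite -lee_fin fineK//; apply: itv_ge.
  move=> x /andP[x1 x2]; apply: normal_pdf_ge.
  by rewrite ler_norml x1 (le_trans x2)// ltW.
by rewrite mulr_ge0 ?normal_peak_ge0 ?expR_ge0.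
Qed.

Lemma normal_prob_gt1_ge :
  normal_peak 1 * expR (- (2 ^+ 2 / (2 * v0))) <= fine (N `]1, +oo[%classic).
Proof.
set c := normal_peak 1 * _.
rewrite -lee_fin fineK; last by rewrite fin_num_measure.
apply: (@le_trans _ _ (N `]1, 2[%classic)).
  have := @normal_prob_itv_ge 1 2 c; rewrite (_ : 2 - 1 = 1) ?mul1r; last by lra.
  apply; rewrite ?ler1n//; last by rewrite mulr_ge0 ?normal_peak_ge0 ?expR_ge0.
  move=> x /andP[x1 x2]; apply: normal_pdf_ge.
  by rewrite ger0_norm// (le_trans _ x1).
apply: le_measure; rewrite ?inE//.
by move=> x /=; rewrite !in_itv/= => /andP[-> _].
Qed.

End FixedVariance.

(** p and g depend on v0 and delta only, which leaves h free to be small compared with p g. All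
    bounds are uniform in s because the noises have different variances. *)
Lemma normal_tails (v0 delta : R) : 0 < v0 -> 0 < delta -> exists p g h : R,
  [/\ 0 < p <= 2^-1, 0 < g <= 2^-1, 0 < h < 1, h <= delta &
   forall s, s != 0 -> v0 <= s ^+ 2 <= 1 ->
     [/\ p <= fine (normal_prob 0 s `]1, +oo[%classic),
         2^-1 - p * g / 4 <= fine (normal_prob 0 s `]h, +oo[%classic) &
         2^-1 + g <= fine (normal_prob 0 s `]- delta, +oo[%classic)]].
Proof.
move=> v00 d0; have k1 : 0 < normal_peak (1 : R) by rewrite normal_peak_gt0.
set p1 := normal_peak 1 * expR (- (2 ^+ 2 / (2 * v0))).
set g1 := delta * (normal_peak 1 * expR (- (delta ^+ 2 / (2 * v0)))).
have p10 : 0 < p1 by rewrite mulr_gt0 ?expR_gt0.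
have g10 : 0 < g1 by rewrite !mulr_gt0 ?expR_gt0.
pose p := Num.min p1 2^-1; pose g := Num.min g1 2^-1.
have p0 : 0 < p by rewrite lt_min p10 invr_gt0 ltr0n.
have g0 : 0 < g by rewrite lt_min g10 invr_gt0 ltr0n.
set k := normal_peak (Num.sqrt v0).
have k0 : 0 < k by rewrite normal_peak_gt0// gt_eqF// sqrtr_gt0.
have q0 : 0 < p * g / 4 / k by rewrite !divr_gt0// mulr_gt0.
(* The last term makes the mass lost on [0, h] at most p g / 4. *)
pose h := Num.min (Num.min 2^-1 delta) (p * g / 4 / k).
have h0 : 0 < h by rewrite !lt_min q0 d0 invr_gt0 ltr0n.
exists p, g, h; split.
- by rewrite p0 ge_min lexx orbT.
- by rewrite g0 ge_min lexx orbT.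
- by rewrite h0 !gt_min; apply/orP; left; apply/orP; left; lra.
- by rewrite !ge_min lexx orbT.
move=> s s0 sv; split.
- by apply: le_trans (normal_prob_gt1_ge s0 v00 sv); rewrite ge_min lexx.
- apply: le_trans (normal_prob_gt_ge s0 v00 sv h0); rewrite lerB// -ler_pdivlMr//.
  by rewrite !ge_min lexx orbT.
- by apply: le_trans (normal_prob_gtN_ge s0 v00 sv d0); rewrite lerD2l ge_min lexx.
Qed.

End NormalTails.

(** * Level sets along the binary sub-tree *)

Section LevelSetPercolation.
Variables (R : realType) (V : choiceType) (e : rel V) (x0 : V).
Hypothesis tree_e : locally_finite_tree e.
Variable S : set V.
Hypothesis binary_S : binary_subtree e x0 S.
Variable D : R.
Hypothesis deg_S : forall x, S x -> (deg e x)%:R <= D.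

Local Notation parent := (parent x0 tree_e).
Local Notation G := (greenR R e).

Let fin_nbrs := finite_neighbors tree_e.
Let dg := deg_gt0 tree_e binary_S.
Let gb := greenN_bounded R tree_e binary_S.
Let Sx0 : S x0. Proof. by case: binary_S. Qed.

(** The two children in S are labelled by booleans, injectively, so that words can index vertices;
    the labelling is arbitrary off S. *)
Lemma exists_child : exists c : V -> bool -> V, forall y, S y ->
  (forall b, [/\ S (c y b), c y b != x0 & parent (c y b) = y]) /\
  injective (c y).
Proof.
suff : forall y, exists c : bool -> V, S y ->
    (forall b, [/\ S (c b), c b != x0 & parent (c b) = y]) /\ injective c.
  by move=> ex; exists (fun y => sval (cid (ex y))) => y; case: cid.
move=> y; have [Sy|Sy] := pselect (S y); last by exists (fun=> y).
have [c1 [c2 [c12 [S1 S2] [c1x0 c2x0] [p1 p2]]]] := two_children tree_e binary_S Sy.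
exists (fun b => if b then c1 else c2) => _; split; first by case.
by move=> [] [] // c; rewrite c eqxx in c12.
Qed.

Definition child := sval (cid exists_child).

Lemma childP y : S y ->
  (forall b, [/\ S (child y b), child y b != x0 & parent (child y b) = y]) /\
  injective (child y).
Proof. by rewrite /child; case: cid => c /= cP; exact: cP. Qed.

Fixpoint vertex (w : word) : V :=
  if w is b :: w' then child (vertex w') b else x0.

Lemma vertex_in w : S (vertex w).
Proof.
elim: w => [//|b w IH] /=.
by have [/(_ b)[]] := childP IH.
Qed.

Lemma vertex_neq_root b w : vertex (b :: w) != x0.
Proof. by have [/(_ b)[]] := childP (vertex_in w). Qed.

Lemma parent_vertex b w : parent (vertex (b :: w)) = vertex w.
Proof. by have [/(_ b)[]] := childP (vertex_in w). Qed.

Lemma vertex_inj : injective vertex.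
Proof.
elim=> [|b w IH] [|b' w'] //.
- by move=> h; have := vertex_neq_root b' w'; rewrite -h eqxx.
- by move=> h; have := vertex_neq_root b w; rewrite h eqxx.
move=> h; have ww : w = w'.
  by apply: IH; rewrite -(parent_vertex b w) h parent_vertex.
move: h; rewrite ww => h; congr (_ :: _).
by have [_] := childP (vertex_in w'); apply.
Qed.

Lemma edge_vertex b w : e (vertex w) (vertex (b :: w)).
Proof.
case: tree_e => e_sym _ _ _ _; rewrite e_sym -[X in e _ X](parent_vertex b w).
by have [] := parentP tree_e (vertex_neq_root b w).
Qed.

(* The probability of ever reaching the parent. *)
Definition coef (w : word) : R :=
  if w is _ :: w' then G (vertex w) (vertex w') / G (vertex w') (vertex w')
  else 0.

(** The walk can step to the parent at once, with probability 1 / deg. *)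
Lemma coef_ge w : w != [::] -> D^-1 <= coef w.
Proof.
case: w => [//|b w] _.
have ewb := edge_vertex b w; have e_sym : symmetric e by case: tree_e.
have := greenR_nbr_ge fin_nbrs dg gb (x := vertex (b :: w)) (y := vertex w).
rewrite e_sym ewb => /(_ isT) h.
have d0 : 0 < (deg e (vertex (b :: w)))%:R :> R by rewrite ltr0n dg.
have dD := deg_S (vertex_in (b :: w)).
apply: (@le_trans _ _ (deg e (vertex (b :: w)))%:R^-1).
  by rewrite lef_pV2// posrE (lt_le_trans d0).
by rewrite /coef ler_pdivlMr// greenR_diag_gt0.
Qed.

(** To reach z outside the subtree, the walk must pass through the parent; this is
    [greenR_separation] with the parent as second pole. *)
Lemma green_below b w z : ~ below x0 tree_e (vertex (b :: w)) z ->
  G (vertex (b :: w)) z = coef (b :: w) * G (vertex w) z.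
Proof.
move=> nz; have Gp : 0 < G (vertex w) (vertex w) by exact: greenR_diag_gt0.
have np : ~ below x0 tree_e (vertex (b :: w)) (vertex w).
  rewrite -[X in below _ _ _ X](parent_vertex b w).
  exact: below_parent (vertex_neq_root b w).
have := @greenR_separation R V e fin_nbrs dg gb
  (below x0 tree_e (vertex (b :: w))) (vertex w) z (vertex w) (vertex (b :: w)).
move=> sep; have {}sep := sep _ nz np (below_refl x0 tree_e _).
rewrite /coef -(mulfK (lt0r_neq0 Gp) (G (vertex (b :: w)) z)) sep; first by ring.
move=> u u' uy euu'; have [?|[_ ->]] := below_edge uy euu'; first by left.
by right; rewrite parent_vertex.
Qed.

Lemma below_root z : below x0 tree_e x0 z.
Proof.
exists (depth x0 tree_e z); apply: (depth_eq0 (tree_e := tree_e)).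
have := depth_iter_parent x0 tree_e z (depth x0 tree_e z).
by rewrite subnn leqn0 => /eqP.
Qed.

Section Field.
Variables (d : measure_display) (T : measurableType d) (P : probability T R).
Variable phi : V -> {RV P >-> R}.
Hypothesis gaussian_phi :
  centered_gaussian_field (fun x y => (G x y / (deg e y)%:R)%:E) phi.

Local Notation span := (field_span phi).
Local Notation inner := (inner P).

Definition psi (w : word) (om : T) : R := phi (vertex w) om.

(** At the empty word [coef] is 0, so the noise there is the field at the root. *)
Definition noise (w : word) (om : T) : R :=
  psi w om - coef w * psi (behead w) om.

Lemma span_noise w : span (noise w).
Proof.
rewrite (_ : noise w = fun om => phi (vertex w) om +
   (- coef w) * phi (vertex (behead w)) om).
  apply: field_spanD; first exact: field_span_phi.
  by apply: field_spanZ; exact: field_span_phi.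
by apply/funext => om; rewrite /noise mulNr.
Qed.

Lemma inner_noise w U : span U -> inner (noise w) U =
  inner (phi (vertex w)) U - coef w * inner (phi (vertex (behead w))) U.
Proof.
move=> sU; rewrite (_ : noise w = fun om => phi (vertex w) om +
   (- coef w) * phi (vertex (behead w)) om); last first.
  by apply/funext => om; rewrite /noise mulNr.
have s1 := field_span_phi phi (vertex w).
have s2 := field_span_phi phi (vertex (behead w)).
rewrite (innerDl gaussian_phi s1 (field_spanZ _ s2) sU).
by rewrite (innerZl gaussian_phi _ s2 sU) mulNr.
Qed.

Lemma inner_phi x y : inner (phi x) (phi y) = G x y / (deg e y)%:R.
Proof. exact: field_covariance gaussian_phi x y. Qed.

(** Outside the subtree of w, [green_below] makes the two covariances cancel. *)
Lemma inner_noise_phi w z : ~ below x0 tree_e (vertex w) z ->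
  inner (noise w) (phi z) = 0.
Proof.
move=> nz; rewrite inner_noise; last exact: field_span_phi.
rewrite !inner_phi; case: w nz => [|b w] nz.
  by exfalso; apply: nz; exact: below_root.
by rewrite green_below//=; ring.
Qed.

(** Of two distinct vertices, one is not below the other, nor then is its parent; so the noise of
    the other is orthogonal to both field values in its noise. *)
Lemma orthogonal_noise w w' : w != w' -> inner (noise w) (noise w') = 0.
Proof.
move=> ww'.
have main u u' : ~ below x0 tree_e (vertex u) (vertex u') ->
    inner (noise u) (noise u') = 0.
  move=> nb; rewrite innerC inner_noise; last exact: span_noise.
  rewrite innerC inner_noise_phi// innerC inner_noise_phi.
    by rewrite mulr0 subr0.
  move=> [i iu]; apply: nb; exists i.+1; rewrite iterSr.
  case: u' iu => [|b u'] /=; last by rewrite -/(vertex (b :: u')) parent_vertex.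
  by rewrite parent_root.
have [bl|] := pselect (below x0 tree_e (vertex w) (vertex w')); last exact: main.
rewrite innerC; apply: main => bl'; move/eqP: ww'; apply; apply: vertex_inj.
exact: below_anti bl bl'.
Qed.

(** The variance is k / deg. Off the root k is Green's function of the walk killed at the parent; it
    is at least 1 by the visit at time 0 and at most deg by [greenR_le_deg]. *)
Lemma variance_noise w : D^-1 <= inner (noise w) (noise w) <= 1.
Proof.
have d0 : 0 < (deg e (vertex w))%:R :> R by rewrite ltr0n dg.
have dD := deg_S (vertex_in w).
suff [k [kE k1 kd]] : exists k, [/\ inner (noise w) (noise w) = k / (deg e (vertex w))%:R,
    1 <= k & k <= (deg e (vertex w))%:R].
  rewrite kE; apply/andP; split; last by rewrite ler_pdivrMr// mul1r.
  apply: (@le_trans _ _ (deg e (vertex w))%:R^-1).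
    by rewrite lef_pV2// posrE (lt_le_trans d0).
  by rewrite ler_peMl// invr_ge0 ltW.
have gd := greenR_le_deg R tree_e binary_S (vertex w) (vertex_in w).
have g1 := greenR_diag_ge1 fin_nbrs dg gb (vertex w).
rewrite inner_noise; last exact: span_noise.
case: w d0 dD gd g1 => [|b w] d0 dD gd g1.
  exists (G x0 x0); split => //.
  rewrite /= mul0r subr0 innerC inner_noise; last exact: field_span_phi.
  by rewrite /= mul0r subr0 inner_phi.
rewrite [inner (phi (vertex (behead _))) _]innerC inner_noise_phi; last first.
  rewrite -[X in below _ _ _ X](parent_vertex b w).
  exact: below_parent (vertex_neq_root b w).
rewrite mulr0 subr0 innerC inner_noise; last exact: field_span_phi.
rewrite !inner_phi.
set y := vertex (b :: w) in d0 dD gd g1 *; set x := vertex w.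
exists (G y y - G y x * G x y / G x x); split.
- by rewrite /coef -/y -/x /=; ring.
- have e_sym : symmetric e by case: tree_e.
  have eyx : e y x by rewrite e_sym; exact: edge_vertex.
  apply: greenR_killed_ge => //; apply/eqP => yx; case: tree_e => _ e_irr _ _ _.
  by rewrite yx e_irr in eyx.
- apply: le_trans gd; rewrite gerBl divr_ge0 ?mulr_ge0//; exact: greenR_ge0.
Qed.

Let D_gt0 : 0 < D.
Proof.
by apply: lt_le_trans (deg_S Sx0); rewrite ltr0n; exact: dg.
Qed.

Lemma measurable_noise w : measurable_fun setT (noise w).
Proof. exact: measurable_field_span (span_noise w). Qed.

Lemma tail_noise w : exists s, [/\ s != 0, D^-1 <= s ^+ 2 <= 1 &
  forall c, tail P noise w c = fine (normal_prob 0 s `]c, +oo[%classic)].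
Proof.
have sZ := span_noise w; have mZ := @measurable_noise w.
have [s [s2 _ law]] := centered_gaussian_rv mZ (gaussian_field_span gaussian_phi sZ)
  (field_span_mean gaussian_phi sZ).
have s2E : s ^+ 2 = inner (noise w) (noise w).
  by rewrite s2 /inner; under eq_Rintegral do rewrite expr2.
have s_itv : D^-1 <= s ^+ 2 <= 1 by rewrite s2E variance_noise.
have s0 : s != 0.
  apply/eqP => s0; move: s_itv; rewrite s0 expr0n/= => /andP[].
  by rewrite leNgt invr_gt0 D_gt0.
exists s; split => // c; rewrite -law//.
have -> : tail P noise w c = \int[P]_om \1_(noise w @^-1` `]c, +oo[%classic) om.
  apply: eq_Rintegral => om _; rewrite indicE; congr ((nat_of_bool _)%:R).
  by apply/idP/idP; rewrite inE /= in_itv/= andbT.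
rewrite /Rintegral integral_indic ?setIT//.
by rewrite -[X in measurable X]setTI; exact: mZ.
Qed.

Lemma percolation : exists h c, [/\ 0 < h, 0 < c &
  forall n, (c%:E <= P [set om | alive psi h n.+1 [::] om])%E].
Proof.
have v0 : 0 < D^-1 by rewrite invr_gt0.
(* delta is D^-1 / 2, since the coefficients are at least D^-1 and have to be at least 2 delta. *)
have [p [g [h [p_itv g_itv /andP[h0 h1] hd tails]]]] :=
  normal_tails v0 (divr_gt0 v0 (ltr0n R 2)).
have tail1 w : p <= tail P noise w 1.
  by have [s [s0 s_itv ->]] := tail_noise w; have [] := tails s s0 s_itv.
have tailh w : 2^-1 - p * g / 4 <= tail P noise w h.
  by have [s [s0 s_itv ->]] := tail_noise w; have [] := tails s s0 s_itv.
have taild w : 2^-1 + g <= tail P noise w (- (D^-1 / 2)).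
  by have [s [s0 s_itv ->]] := tail_noise w; have [] := tails s s0 s_itv.
exists h, (tail P noise [::] 1 * (p * g)); split => //.
  have /andP[p0 _] := p_itv; have /andP[g0 _] := g_itv.
  by rewrite !mulr_gt0// (lt_le_trans p0).
apply: (@alive_probability _ _ _ P noise measurable_noise _ coef psi (D^-1 / 2)) => //.
- apply: (@independent_product _ _ _ P _ noise (fun w => inner (noise w) (noise w))).
    exact: measurable_noise.
  move=> js t th ujs.
  exact: (orthogonal_cos gaussian_phi span_noise orthogonal_noise).
- by move=> w w0; rewrite mulrC divfK ?pnatr_eq0//; exact: coef_ge.
- by apply/funext => om; rewrite /noise /= mul0r subr0.
- by move=> b w om; rewrite /noise /=; ring.
Qed.

Lemma alive_cluster h h' n w om : h' <= h -> alive psi h n.+1 w om ->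
  exists2 u, size u = n &
    cluster_of e [set y | h' <= phi y om] (vertex w) (vertex (u ++ w)).
Proof.
move=> hh'; elim: n w => [|n IH] w.
  move=> [hw _]; exists [::] => //; exists [::]; split => // z.
  by rewrite inE => /eqP -> /=; rewrite (le_trans hh')// ltW.
move=> [hw al].
have [b alb] : exists b, alive psi h n.+1 (b :: w) om.
  by case: al => al; [exists true|exists false].
have [u su [q [pq qA lq]]] := IH _ alb.
exists (rcons u b); first by rewrite size_rcons su.
exists (vertex (b :: w) :: q); split.
- by rewrite /= -/(vertex (b :: w)) edge_vertex.
- move=> z; rewrite in_cons => /orP[/eqP ->|]; last exact: qA.
  by rewrite /= (le_trans hh')// ltW.
- by rewrite cat_rcons.
Qed.

Lemma h_star_gt0 : (0 < h_star e phi)%E.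
Proof.
have [h [c [h0 c0 al]]] := percolation.
apply: (@lt_le_trans _ _ h%:E); first by rewrite lte_fin.
apply: le_ereal_inf_tmp => _ [h' /= [N [mN PN0 subN]] <-].
(* A level h' < h would put the intersection of the [A n], of probability at least c, inside a null
   set. *)
rewrite lee_fin leNgt; apply/negP => h'h.
pose A n := [set om | alive psi h n.+1 [::] om].
have mA n : measurable (A n).
  apply: (measurable_alive (a := coef) measurable_noise).
    by apply/funext => om; rewrite /noise /= mul0r subr0.
  by move=> b w om; rewrite /noise /=; ring.
have mcapA : measurable (\bigcap_n A n) by exact: bigcap_measurable.
have AN : \bigcap_n A n `<=` N.
  move=> om Aom; apply: subN => /= /(_ x0) fin.
  have /choice[u u_def] n : exists u, size u = n /\
      cluster_of e [set y | h' <= phi y om] x0 (vertex u).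
    have [u su uc] := alive_cluster (ltW h'h) (Aom n I).
    by exists u; rewrite cats0 in uc.
  (* Words of every length already give infinitely many vertices in the cluster of x0, so no
     infinite branch has to be extracted. *)
  apply: infinite_nat; rewrite (_ : setT = (vertex \o u) @^-1`
      cluster_of e [set y | h' <= phi y om] x0); last first.
    by apply/seteqP; split => // n _; have [] := u_def n.
  apply: finite_preimage fin => m n _ _ /vertex_inj mn.
  by have [<- _] := u_def m; have [<- _] := u_def n; rewrite mn.
have decA : {homo A : n m / (n <= m)%N >-> (m <= n)%O}.
  have dec w om : forall n m, (n <= m)%N -> alive psi h m w om -> alive psi h n w om.
    move=> n m; elim: n m w => [//|n IH] [//|m] w nm [hw al'].
    by split => //; case: al' => al'; [left|right]; apply: IH al'.
  by move=> n m nm; apply/subsetPset => om; apply: dec; rewrite ltnS.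
have PA0 : (P (A 0%N) < +oo)%E by rewrite ltey_eq fin_num_measure.
have cvgA := nonincreasing_cvg_mu PA0 mA mcapA decA.
have : (c%:E <= P (\bigcap_n A n))%E.
  rewrite -(cvg_lim _ cvgA)//; apply: lime_ge; first by apply/cvg_ex; eexists; exact: cvgA.
  by near=> n; exact: al.
have : (P (\bigcap_n A n) <= P N)%E by apply: le_measure; rewrite ?inE.
rewrite PN0 => PA cPA; have := le_trans cPA PA.
by rewrite lee_fin leNgt c0.
Unshelve. all: by end_near.
Qed.

End Field.
End LevelSetPercolation.

Theorem proposition4p2 (R : realType) (V : choiceType) (e : rel V) (x0 : V)
    (tree_e : locally_finite_tree e)
    (S : set V) (binary_S : binary_subtree e x0 S)
    (M : R) (M_gt0 : 0 < M)
    (bounded_S : (ereal_sup [set ((nb_children e x0 x)%:R : R)%:E | x in S]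
                  <= M%:E)%E)
    (d : measure_display) (W : measurableType d)
    (Px : V -> probability W R) (X : nat -> W -> V)
    (srw_X : is_srw e Px X) :
  transient Px X /\
  (forall (d' : measure_display) (Omega : measurableType d')
     (P : probability Omega R) (phi : V -> {RV P >-> R}),
     centered_gaussian_field (green e Px X) phi -> (0 < h_star e phi)%E).
Proof.
have fin_nbrs := finite_neighbors tree_e.
have dg := deg_gt0 tree_e binary_S.
have gb := greenN_bounded R tree_e binary_S.
have transient_X := srw_transient fin_nbrs dg srw_X gb.
split; first exact: transient_X.
move=> d' Omega P phi gaussian_phi.
(* The extra 1 accounts for the parent. *)
have deg_S x : S x -> (deg e x)%:R <= M + 1.
  move=> Sx; rewrite (@le_trans _ _ (nb_children e x0 x).+1%:R)//.
    by rewrite ler_nat deg_le_nb_children.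
  rewrite -natr1 lerD2r -lee_fin (le_trans _ bounded_S)//.
  by apply: ereal_sup_ubound; exists x.
apply: (h_star_gt0 tree_e binary_S deg_S).
have {gaussian_phi}[? ? cov] := gaussian_phi; split => // x y.
by rewrite cov (srw_green fin_nbrs dg srw_X gb).
Qed.
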